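(* Let $\Sigma\subset\mathbb{R}^2$ be a compact planar surface, $D\subset\Sigma$ a tangle diagram with no closed link components, and $U\subset\mathrm{int}(\Sigma)$ a compact subsurface whose boundary is transverse to $D$ and avoids crossing points; let $D/U$ be the contraction of $D$ by $U$. Then the Green's function of $D/U$, $$g_{D/U}:\mathcal{S}(D/U)\times\mathcal{S}(D/U)\to\mathbb{Z}(T),$$ is well-defined for all $T\in\mathbb{C}$ in an open neighborhood of $1$. For all $s,t\in\mathcal{S}(D/U)\subset\mathcal{S}(D)$, $$g_{D/U}(s,t)=g_D(s,t).$$
   Context: **Markov chains.** A Markov chain $M=(\mathcal{S},a)$ consists of a finite set of states $\mathcal{S}=\mathcal{S}(M)$ and a transition function $a=a_M:\mathcal{S}\times\mathcal{S}\to R$ ($R$ a commutative ring with unity). A walk from $s$ to $t$ is a finite sequence of states $w=s_1s_2\cdots s_k$ with $s_1=s$, $s_k=t$, $k\ge1$, $a(s_i,s_{i+1})\ne0$ for $1\le i<k$; its weight is $a(w)=\prod_{i=1}^{k-1}a(s_i,s_{i+1})$ (equal to $1$ if $k=1$). The Green's function is $g_M(s,t)=\sum_w a(w)$, the sum over all walks from $s$ to $t$, whenever this converges. Here $R=\mathbb{Z}[T,T^{-1}]$ or $\mathbb{Z}(T)$, the sum is taken at complex values of $T$, and well-definedness on an open neighborhood of $1$ means absolute convergence there to a rational function in $\mathbb{Z}(T)$. **Tangle diagrams.** A tangle diagram $D\subset\Sigma$ is the oriented image of a generic projection of a proper embedding of an oriented compact 1-manifold in $\Sigma\times I$, with over/under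 information at crossings. Its strands are the components of $D$ minus the crossing points; a strand meeting $\partial\Sigma$ is incoming if its orientation there points into $\Sigma$ and outgoing otherwise. $D$ determines a Markov chain, also denoted $D$, with states $\mathcal{S}(D)$ the strands of $D$ and transition function as follows: at a crossing of sign $\sigma$ with incoming over-strand $i$, incoming under-strand $j$, outgoing over-strand $i^+$ and outgoing under-strand $j^+$, $a_D(i,i^+)=T^\sigma$, $a_D(i,j^+)=1-T^\sigma$, $a_D(j,j^+)=1$; all other values are $0$. If $D$ has no closed components, then $g_D$ is well-defined for $T$ in an open neighborhood of $1$, with values in $\mathbb{Z}(T)$. **Contraction.** $U$ defines two subdiagrams $D\cap U$ and $D\cap(\Sigma-U)$, denoted $U$ and $D-U$. Via inclusion their strands $\mathcal{S}(U)$ and $\mathcal{S}(D-U)$ are identified with subsets of $\mathcal{S}(D)$ (so each strand of $D$ meets $\partial U$ in at most one point), and $\mathcal{S}(U)\cap\mathcal{S}(D-U)$ consists of the incoming strands $\mathcal{I}$ and the outgoing strands $\mathcal{O}$ of $U$. The contraction $D/U$ is the Markov chain with states $\mathcal{S}(D/U)=\mathcal{S}(D-U)$ and transition function $$a_{D/U}(s,t)=\begin{cases}g_U(s,t)& s\in\mathcal{I},\ t\in\mathcal{O}\\ a_D(s,t)&\text{otherwise,}\end{cases}$$ where $g_U$ is the Green's function of the Markov chain of the tangle diagram $U$ (i.e. the sum of weights over walks taking place inside $U$). *)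

(* Defs.v *)
From HB Require Import structures.
From mathcomp Require Import all_boot all_order all_algebra fraction.
From mathcomp Require Import finmap.
From mathcomp Require Import all_classical all_reals all_analysis.
From mathcomp Require Import complex.

Set Implicit Arguments.
Unset Strict Implicit.
Unset Printing Implicit Defensive.

Import Order.TTheory GRing.Theory Num.Theory.
Import numFieldNormedType.Exports.

#[global] Open Scope ring_scope.
#[global] Open Scope classical_set_scope.

Notation ZT := {fraction {poly int}}.
Definition Tvar : ZT := tofrac 'X.

(* The value does not depend on the fraction p / q representing f, as long as
   its denominator does not vanish at z. *)
Definition ZT_value (R : realType) (f : ZT) (z v : R[i]) : Prop :=
  exists p q : {poly int},
    [/\ f = tofrac p / tofrac q,
        (map_poly intr q).[z] != 0 &
        v = (map_poly intr p).[z] / (map_poly intr q).[z]].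

Definition regular_at (R : realType) (f : ZT) (z : R[i]) : Prop :=
  exists v, ZT_value f z v.

(* Evaluation of a rational function; 0 at a pole. *)
Definition ZT_eval (R : realType) (f : ZT) (z : R[i]) : R[i] :=
  xget 0 [set v | ZT_value f z v].

(* The states form a finite subset of an ambient type, and only the values of
   [trans] on states matter.  All the chains derived from one diagram share
   their ambient type, so that S(D / U) is a subset of S(D). *)
Record markov_chain (S : choiceType) := MarkovChain {
  states : set S ;
  states_finite : finite_set states ;
  trans : S -> S -> ZT
}.

Definition walks (S : choiceType) (M : markov_chain S) (s t : S) :
    set (seq S) :=
  [set w : seq S | [/\ forall x : S, x \in w -> states M x,
               ohead w = Some s,
               last s w = t &
               sorted (fun x y => trans M x y != 0) w]].

Fixpoint weight (S : choiceType) (M : markov_chain S) (w : seq S) : ZT :=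
  match w with
  | s :: ((t :: _) as w') => trans M s t * weight M w'
  | _ => 1
  end.

(* The family f converges absolutely on A, with (unordered) sum v. *)
Definition abs_sum (R : realType) (I : choiceType) (A : set I) (f : I -> R[i])
    (v : R[i]) : Prop :=
  summable A (fun i => (Normc.normc (f i))%:E) /\
  forall e : R, 0 < e ->
    exists2 F0 : {fset I}, [set` F0] `<=` A &
      forall F : {fset I}, [set` F0] `<=` [set` F] -> [set` F] `<=` A ->
        Normc.normc (\sum_(i <- enum_fset F) f i - v) < e.

Definition green_at (R : realType) (S : choiceType) (M : markov_chain S)
    (s t : S) (g : ZT) (z : R[i]) : Prop :=
  [/\ regular_at g z,
      forall w, walks M s t w -> regular_at (weight M w) z &
      abs_sum (walks M s t) (fun w => ZT_eval (weight M w) z) (ZT_eval g z)].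

(* R[i] carries its usual topology through the alias R[i]^o. *)
Definition green_well_defined (R : realType) (S : choiceType)
    (M : markov_chain S) : Prop :=
  exists g : S -> S -> ZT, \forall z \near (1 : R[i]^o),
    forall s t, states M s -> states M t -> green_at M s t (g s t) z.

(* The rational function whose values near T = 1 are the sums over walks. *)
Definition green (R : realType) (S : choiceType) (M : markov_chain S)
    (s t : S) : ZT :=
  xget 0 [set g | \forall z \near (1 : R[i]^o), green_at M s t g z].

Notation plane R := (R * R)%type.

Definition det2 (R : realType) (u v : plane R) : R := u.1 * v.2 - u.2 * v.1.

(* f is a C^1 local defining function of W at p: near p, W = {f <= 0}, with
   f p = 0 and nonzero differential at p. *)
Definition defining_function (R : realType) (W : set (plane R)) (p : plane R)
    (f : plane R -> R) : Prop :=
  [/\ f p = 0,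
      \forall q \near p, differentiable f q /\
        forall v : plane R, {for q, continuous (fun x => 'D_v f x)},
      exists v : plane R, 'D_v f p != 0 &
      \forall q \near p, W q <-> f q <= 0].

(* A compact 2-dimensional C^1 submanifold with boundary of the plane. *)
Definition planar_surface (R : realType) (W : set (plane R)) : Prop :=
  compact W /\
  forall p, W p -> W° p \/ exists f, defining_function W p f.

Definition bdry (R : realType) (W : set (plane R)) : set (plane R) :=
  W `\` W°.

Definition transverse_to_bdry (R : realType) (W : set (plane R))
    (p v : plane R) : Prop :=
  exists2 f, defining_function W p f & 'D_v f p != 0.

Definition points_into (R : realType) (W : set (plane R))
    (p v : plane R) : Prop :=
  exists2 f, defining_function W p f & 'D_v f p < 0.

(* A parametrized oriented compact 1-manifold mapped to (plane) x I.  An arc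
   component is parametrized by [0, 1], a closed component by [0, 1[ through a
   1-periodic map; other parameter values are irrelevant for arcs. *)
Record curves (R : realType) := Curves {
  component : finType ;
  is_circle : pred component ;
  emb : component -> R -> (plane R * R)%type
}.

Definition pts (R : realType) (D : curves R) : set (component D * R) :=
  [set x | 0 <= x.2 /\ (if is_circle x.1 then x.2 < 1 else x.2 <= 1)].

Definition endpoint (R : realType) (D : curves R) (x : component D * R) :
    Prop :=
  ~~ is_circle x.1 /\ (x.2 = 0 \/ x.2 = 1).

Definition curve (R : realType) (D : curves R) (k : component D) (t : R) :
    plane R :=
  (emb k t).1.
Definition point_of (R : realType) (D : curves R) (x : component D * R) :
    plane R :=
  curve x.1 x.2.
Definition height (R : realType) (D : curves R) (x : component D * R) : R :=
  (emb x.1 x.2).2.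
Definition velocity (R : realType) (D : curves R) (x : component D * R) :
    plane R :=
  (curve x.1)^`() x.2.

Definition double_points (R : realType) (D : curves R) :
    set (component D * R) :=
  [set x | pts x /\ exists y, [/\ pts y, y <> x & point_of y = point_of x]].

(* A proper embedding in Sigma x I, I = [0, 1], with generic projection to
   Sigma; the over/under information at a double point is given by the
   heights.  A C^1 map on [0, 1] is one extending to a C^1 map near [0, 1]. *)
Record tangle_axioms (R : realType) (Sigma : set (plane R)) (D : curves R) :
    Prop := {
  emb_periodic : forall k : component D, is_circle k ->
    forall t, emb k (t + 1) = emb k t ;
  emb_C1 : forall x : component D * R, pts x ->
    derivable (emb x.1) x.2 1 /\ {for x.2, continuous (emb x.1)^`()} ;
  emb_inj : forall x y : component D * R, pts x -> pts y ->
    emb x.1 x.2 = emb y.1 y.2 -> x = y ;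
  emb_bdry : forall x : component D * R, pts x -> endpoint x ->
    bdry Sigma (point_of x) /\ 0 <= height x <= 1 ;
  emb_int : forall x : component D * R, pts x -> ~ endpoint x ->
    Sigma° (point_of x) /\ 0 < height x < 1 ;
  proj_immersed : forall x : component D * R, pts x -> velocity x != 0 ;
  double_finite : finite_set (@double_points R D) ;
  double_interior : forall x : component D * R,
    double_points x -> ~ endpoint x ;
  double_transverse : forall x y : component D * R, pts x -> pts y -> x <> y ->
    point_of x = point_of y -> det2 (velocity x) (velocity y) != 0 ;
  no_triple : forall x y z : component D * R, pts x -> pts y -> pts z ->
    point_of x = point_of y -> point_of y = point_of z ->
    [\/ x = y, y = z | x = z]
}.

Record tangle_diagram (R : realType) (Sigma : set (plane R)) := TangleDiagram {
  tangle_curves :> curves R ;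
  tangle_axiomsP : tangle_axioms Sigma tangle_curves
}.

Definition diagram_set (R : realType) (D : curves R) : set (plane R) :=
  (@point_of R D) @` (@pts R D).
Definition crossing_points (R : realType) (D : curves R) : set (plane R) :=
  (@point_of R D) @` (@double_points R D).

Definition strands (R : realType) (D : curves R) : set (set (plane R)) :=
  let A := diagram_set D `\` crossing_points D in connected_component A @` A.

(* There is a crossing with over-strand through x and under-strand through y. *)
Definition crossing (R : realType) (D : curves R) (x y : component D * R) :
    Prop :=
  [/\ pts x, pts y, point_of x = point_of y & height y < height x].

(* Right-handed crossings, for which (over, under) is a positive basis of the
   plane, are positive. *)
Definition crossing_sign (R : realType) (D : curves R)
    (x y : component D * R) : int :=
  sgz (det2 (velocity x) (velocity y)).

(* s is the strand which ends, resp. starts, at parameter x. *)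
Definition strand_into (R : realType) (D : curves R) (s : set (plane R))
    (x : component D * R) : Prop := \forall t \near x.2^'-, s (curve x.1 t).
Definition strand_from (R : realType) (D : curves R) (s : set (plane R))
    (x : component D * R) : Prop := \forall t \near x.2^'+, s (curve x.1 t).

(* The value a is assigned to (s, t) by a crossing lying in W. *)
Definition crossing_value (R : realType) (D : curves R) (W : set (plane R))
    (s t : set (plane R)) (a : ZT) : Prop :=
  exists x y : component D * R, [/\ crossing x y, W (point_of x) &
    [\/ [/\ strand_into s x, strand_from t x & a = Tvar ^ crossing_sign x y],
        [/\ strand_into s x, strand_from t y & a = 1 - Tvar ^ crossing_sign x y]
      | [/\ strand_into s y, strand_from t y & a = 1]]].

Definition crossing_trans (R : realType) (D : curves R) (W : set (plane R))
    (s t : set (plane R)) : ZT :=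
  xget 0 [set a | crossing_value D W s t a].

Lemma interval_minus_finite (R : realType) (F A : set R) :
  finite_set F -> is_interval A ->
  exists2 L : set (set R), finite_set L &
    (forall B, L B -> is_interval B /\ B `<=` A `\` F) /\
    A `\` F `<=` \bigcup_(B in L) B.
Proof.
move=> /finite_seqP[r ->{F}]; elim: r A => [|x r IH] A iA.
  exists [set A]; first exact: finite_set1.
  split=> [B ->|t [At _]]; last by exists A.
  by split=> // t At; split.
have iI (b : bool) :
    is_interval (A `&` [set t | if b then t < x else x < t]).
  move=> a c [Aa /= ax] [Ac /= xc] t act; split; first exact: iA Aa Ac _ act.
  move: act ax xc => /andP[act tct]; case: b => /= ax xc.
    exact: le_lt_trans tct xc.
  exact: lt_le_trans ax act.
have [L1 F1 [S1 C1]] := IH _ (iI true).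
have [L2 F2 [S2 C2]] := IH _ (iI false).
exists (L1 `|` L2); first by rewrite finite_setU.
split=> [B LB|t [At tr]].
- have [b [iB sB]] : exists b : bool, is_interval B /\
      B `<=` (A `&` [set t | if b then t < x else x < t]) `\` [set` r].
    by case: LB => [/S1|/S2] ?; [exists true|exists false].
  split=> // t /sB[[At tx] tr]; split=> //= /[!inE]/orP[/eqP tE|];
    last exact: tr.
  by move: tx; rewrite /= tE ltxx; case: (b).
- have {}tr : ~ (t == x) /\ ~ (t \in r).
    by split=> h; apply: tr; rewrite /= inE h ?orbT.
  have [tx|xt|te] := ltgtP t x; last by case: tr; rewrite te eqxx.
  + by have [|B LB Bt] := C1 t; [split=> //; case: tr|exists B => //; left].
  + by have [|B LB Bt] := C2 t; [split=> //; case: tr|exists B => //; right].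
Qed.

Lemma curve_continuous (R : realType) (Sigma : set (plane R))
    (D : tangle_diagram Sigma) (x : component D * R) :
  pts x -> {for x.2, continuous (curve x.1)}.
Proof.
move=> px; have [/derivable1_diffP df _] := emb_C1 (tangle_axiomsP D) px.
have /= ec := differentiable_continuous df.
by rewrite /continuous_at /curve; apply: (cvg_comp _ _ ec); exact: cvg_fst.
Qed.

Lemma strands_finite (R : realType) (Sigma : set (plane R))
    (D : tangle_diagram Sigma) : finite_set (strands D).
Proof.
rewrite /strands; set A := _ `\` _ => /=.
pose dom (k : component D) : set R := [set t | pts (k, t)].
pose F (k : component D) : set R := [set t | double_points (k, t)].
have finF k : finite_set (F k).
  apply: (@sub_finite_set _ _ (snd @` @double_points R D)).
    by move=> t Ft; exists (k, t).
  exact/finite_image/(double_finite (tangle_axiomsP D)).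
have idom k : is_interval (dom k).
  move=> a b [/= a0 _] [/= _ b1] c /andP[ac cb]; split=> /=.
    exact: le_trans a0 ac.
  by case: (is_circle k) b1; [exact: le_lt_trans|exact: le_trans].
have inA k t : dom k t -> ~ F k t -> A (curve k t).
  move=> dt nF; split; first by exists (k, t).
  case=> y dy ye; apply: nF; rewrite /F /=.
  have [<-//|/eqP yk] := eqVneq y (k, t).
  by split=> //; exists y; split=> //; case: dy.
have /choice[L HL] k : exists L : set (set R), finite_set L /\
    (forall B, L B -> is_interval B /\ B `<=` dom k `\` F k) /\
    dom k `\` F k `<=` \bigcup_(B in L) B.
  by have [L ? ?] := interval_minus_finite (finF k) (idom k); exists L.
pose h (k : component D) (B : set R) :=
  connected_component A (curve k (xget 0 B)).
apply: (@sub_finite_set _ _ (\bigcup_(k in [set: component D]) (h k @` L k)));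
  last first.
  apply: bigcup_finite; first exact: finite_finset.
  by move=> k _; apply: finite_image; case: (HL k).
move=> _ [p [[[k t] /= px pE] ncp] <-].
have [_ [sub cov]] := HL k.
have nFt : ~ F k t by move=> Ft; apply: ncp; exists (k, t).
have [B LB Bt] : (\bigcup_(B in L k) B) t by exact: cov.
exists k => //; exists B => //; rewrite /h.
have [iB BF] := sub _ LB.
have Bx : B (xget 0 B) by exact: (xgetI 0 Bt).
apply: same_connected_component.
apply: (@connected_component_max _ A (curve k @` B)).
- by exists (xget 0 B).
- by move=> _ [u /BF[du nFu] <-]; exact: inA.
- apply: connected_continuous_connected; first exact/connected_intervalP.
  apply: continuous_in_subspaceT => u /set_mem/BF[du _].
  exact: (@curve_continuous _ _ D (k, u)).
- by exists t.
Qed.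

Definition strands_in (R : realType) (D : curves R) (W : set (plane R)) :
    set (set (plane R)) := [set s | strands D s /\ s `&` W !=set0].

Lemma strands_in_finite (R : realType) (Sigma : set (plane R))
    (D : tangle_diagram Sigma) (W : set (plane R)) :
  finite_set (strands_in D W).
Proof. by apply: sub_finite_set (strands_finite D) => s []. Qed.

(* The chain of the subdiagram of D in the region W.  The strands of the
   subdiagram are identified with strands of D via inclusion, and only the
   crossings in W contribute. *)
Definition subchain (R : realType) (Sigma : set (plane R))
    (D : tangle_diagram Sigma) (W : set (plane R)) :
    markov_chain (set (plane R)) :=
  MarkovChain (strands_in_finite D W) (crossing_trans D W).

Definition diagram_chain (R : realType) (Sigma : set (plane R))
    (D : tangle_diagram Sigma) : markov_chain (set (plane R)) :=
  subchain D Sigma.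

(* Strands of D shared by U and its complement, according to whether the
   orientation points into U where they meet its boundary. *)
Definition incoming (R : realType) (D : curves R) (U : set (plane R)) :
    set (set (plane R)) :=
  [set s | [/\ strands_in D U s, strands_in D (~` U) s &
    exists x : component D * R, [/\ pts x, s (point_of x), bdry U (point_of x) &
      points_into U (point_of x) (velocity x)]]].
Definition outgoing (R : realType) (D : curves R) (U : set (plane R)) :
    set (set (plane R)) :=
  [set s | [/\ strands_in D U s, strands_in D (~` U) s &
    exists x : component D * R, [/\ pts x, s (point_of x), bdry U (point_of x) &
      ~ points_into U (point_of x) (velocity x)]]].

Definition diagram_contraction (R : realType) (Sigma : set (plane R))
    (D : tangle_diagram Sigma) (U : set (plane R)) :
    markov_chain (set (plane R)) :=
  MarkovChain (strands_in_finite D (~` U))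
    (fun s t => if `[< incoming D U s /\ outgoing D U t >]
                then green R (subchain D U) s t
                else trans (diagram_chain D) s t).

(* Main.v *)
Require Import Defs.
From mathcomp Require Import all_boot all_order all_algebra fraction.
From mathcomp Require Import finmap.
From mathcomp Require Import all_classical all_reals all_analysis.
From mathcomp Require Import complex.
From mathcomp Require Import ring lra.

Set Implicit Arguments.
Unset Strict Implicit.
Unset Printing Implicit Defensive.

Import Order.TTheory GRing.Theory Num.Theory.
Import numFieldNormedType.Exports.

Local Open Scope classical_set_scope.
Local Open Scope ring_scope.

(** The Green's function of a finite chain with transition matrix [A] should be
    the entrywise value of [(1 - A)^-1], and contracting a region is block
    elimination (a Schur complement) in the linear system [(1 - A) G = 1].

    Convergence near [T = 1].  A crossing lets a walker jump from the over- to
    the under-strand with weight [1 - T^sigma], which vanishes at [T = 1].  So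
    at [T = 1] the only surviving transitions follow a component of the diagram
    forward; as there are no closed components, a parameter value chosen on
    each strand ([strand_pos]) strictly increases along them, and [A] is
    strictly triangular.  Hence [1 - A] is invertible over the rational
    functions, the entries of its inverse [G] are regular at 1
    ([green_eqn_solution]), and there are positive weights [h] on the states,
    powers of a small constant, with [|A| h <= h / 2] at [T = 1] with strict
    room, hence also near [T = 1] ([lyapunov]).  This inequality says that the
    walks with [m] steps contribute at most a constant times [2^-m], which
    gives absolute convergence; the Neumann expansion of [G] with remainder
    identifies the sum with [G] ([abs_sum_paths], [green_atP]).  A rational
    function is determined by its values near 1 ([ZT_eq_near]), so any solution
    of [(1 - A) G = 1] that is regular at 1 is the Green's function
    ([greenE]).

    Geometry.  Without closed components a strand is the image of a maximal
    interval of parameters without double points, because such images are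
    relatively clopen in the diagram minus its crossings ([connected_clear]).
    So a strand ends at one passage through a crossing and starts at one
    passage at most, and the sums [A_D = A_U + A_V] over crossings inside and
    outside of [U] make sense ([crossing_trans_split]).  Following a strand to
    its first or last boundary point of [U] shows that a strand which [U] shares
    with its complement is incoming if it ends at a crossing in [U], outgoing if
    it starts at one, and not incoming if it ends at a crossing outside of [U];
    it cannot be both incoming and outgoing, since it meets the boundary once.

    Contraction.  By [greenE] it suffices that the restriction of [G_D] to the
    strands outside [U] solves the system of the contraction
    ([contraction_eqn]).  For a strand which is not incoming the two rows of
    transitions agree.  For an incoming strand [s], solving the rows of the
    strands of [U] for [G_D] in terms of the Green's function [G_U]
    ([G_through_U]) gives [G_D(s,t) = sum_u G_U(s,u) G_D(u,t)] over the
    outgoing [u], up to the Kronecker symbol.  Finally the contraction is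
    again strictly triangular at [T = 1], since for [u] other than [s] the value
    of [G_U(s,u)] can only be nonzero there if [u] lies further along than [s]
    ([green_value1]). *)

(** * Values of rational functions *)

Lemma horner_cvg (K : numFieldType) (p : {poly K}) (z : K^o) :
  (fun x : K^o => p.[x] : K^o) @ z --> (p.[z] : K^o).
Proof.
have FF := nbhs_filter z.
elim/poly_ind: p => [|p c IH].
  rewrite (_ : (fun x : K^o => (horner 0 x : K^o)) = cst (0:K^o));
    last by apply/funext => x; rewrite horner0.
  rewrite /= (@horner0 K). exact (@cvg_cst K^o 0 _ (nbhs z) (nbhs_filter z)).
rewrite (@hornerMXaddC K) (_ : (fun x => _) = fun x : K^o =>
  ((p.[x] : K^o) * x : K^o) + (c : K^o)); last first.
  by apply/funext => x; rewrite (@hornerMXaddC K).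
have h0 : (id : K^o -> K^o) @ z --> z by exact (fun A hA => hA).
have h2 := @cvg_cst K^o c _ (nbhs z) FF.
have h1 := @cvgM K K^o (nbhs z) FF (fun x : K^o =>
    p.[x] : K^o) id p.[z] z IH h0.
exact (@cvgD K K^o _ (nbhs z) FF _ _ _ _ h1 h2).
Qed.

Lemma horner_near_neq0 (K : numFieldType) (q : {poly K}) (z : K^o) :
  q.[z] != 0 -> \forall x \near z, q.[x] != 0.
Proof. by move=> q0; exact: (@cvgr_neq0 K K^o _ _ _ _ _ (@horner_cvg K q z)
  q0). Qed.

Lemma horner_div_near (K : numFieldType) (p q : {poly K}) (z : K^o) (e : K) :
  q.[z] != 0 -> 0 < e ->
  \forall x \near z, `|p.[z] / q.[z] - p.[x] / q.[x]| < e.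
Proof.
move=> q0 e0; have FF := nbhs_filter z.
have h := @cvgV K K^o (nbhs z) FF _ _ q0 (@horner_cvg K q z).
have h' := @cvgM K K^o (nbhs z) FF _ _ _ _ (@horner_cvg K p z) h.
exact: (@cvgr_dist_lt K K^o _ _ FF _ _ h' e e0).
Qed.

(** Every neighbourhood contains more points than the polynomial can have
    roots. *)
Lemma poly_eq0_near (K : numFieldType) (p : {poly K}) (z : K^o) :
  (\forall x \near z, p.[x] = 0) -> p = 0.
Proof.
move=> [/= e e0 He].
pose r := [seq z + e / k.+2%:R | k <- iota 0 (size p)].
apply: (@roots_geq_poly_eq0 K p r); last by rewrite size_map size_iota.
- apply/allP => _ /mapP[k _ ->]; apply/rootP/He => /=.
  rewrite opprD addNKr normrN ger0_norm ?divr_ge0 ?(ltW e0)//.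
  by rewrite ltr_pdivrMr ?ltr0n// ltr_pMr// ltr1n.
- rewrite map_inj_uniq ?iota_uniq// =>
    k l /addrI /(mulfI (lt0r_neq0 e0)) /invr_inj /eqP.
  by rewrite eqr_nat => /eqP[].
Qed.

Section RationalValues.
Variable R : realType.
Local Notation C := R[i].
Local Notation normc := Normc.normc.
Implicit Types (f g : ZT) (z v w : C) (p q : {poly int}).

Local Notation ev p z := ((map_poly intr p : {poly C}).[z]).

Lemma normcD z w : normc (z + w) <= normc z + normc w.
Proof. by rewrite -lecR rmorphD; exact: (ler_normD z w). Qed.

Lemma normc_opp z : normc (- z) = normc z.
Proof. by apply: complexI; exact: (normrN z). Qed.

Lemma normc_ge0 z : 0 <= normc z.
Proof. by rewrite -lecR; exact: (normr_ge0 z). Qed.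

Lemma normc_sum (I : Type) (r : seq I) (P : pred I) (f : I -> C) :
  normc (\sum_(i <- r | P i) f i) <= \sum_(i <- r | P i) normc (f i).
Proof.
elim/big_rec2 : _ => [|i x y _ yx]; first by rewrite Normc.normc0.
by apply: le_trans (normcD _ _) _; rewrite lerD2l.
Qed.

Lemma ev_neq0 q z : ev q z != 0 -> tofrac q != 0.
Proof.
by move=> q0; rewrite tofrac_eq0; apply: contraNneq q0 => ->;
  rewrite rmorph0 horner0.
Qed.

(** [f = p / q = p' / q'] gives [p q' = p' q], which can be evaluated. *)
Lemma ZT_value_uniq f z v w : ZT_value f z v -> ZT_value f z w -> v = w.
Proof.
move=> [p [q [fE q0 ->]]] [p' [q' [fE' q0' ->]]].
have t0 := ev_neq0 q0; have t0' := ev_neq0 q0'.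
have e : p * q' = p' * q.
  apply/eqP; rewrite -tofrac_eq !tofracM.
  by rewrite -(eqr_div (tofrac p) (tofrac p') t0 t0') -fE fE'.
apply/eqP; rewrite eqr_div // -!hornerM -!rmorphM /= e.
by [].
Qed.

Lemma ZT_value_eval f z v : ZT_value f z v -> ZT_eval f z = v.
Proof.
by move=> fv; apply: xget_unique => // w fw; exact: ZT_value_uniq fw fv.
Qed.

Lemma regular_value f z : regular_at f z -> ZT_value f z (ZT_eval f z).
Proof. by move=> [v fv]; rewrite (ZT_value_eval fv). Qed.

Lemma ZT_value_poly p z : ZT_value (tofrac p) z (ev p z).
Proof.
by exists p, 1; rewrite tofrac1 rmorph1 hornerC !divr1 oner_eq0.
Qed.

Lemma ZT_value0 z : ZT_value 0 z 0.
Proof. by have := ZT_value_poly 0 z; rewrite tofrac0 rmorph0 horner0. Qed.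

Lemma ZT_value1 z : ZT_value 1 z 1.
Proof. by have := ZT_value_poly 1 z; rewrite tofrac1 rmorph1 hornerC. Qed.

Lemma ZT_valueT z : ZT_value Tvar z z.
Proof. by have := ZT_value_poly 'X z; rewrite map_polyX hornerX. Qed.

Lemma ZT_valueD f g z v w :
  ZT_value f z v -> ZT_value g z w -> ZT_value (f + g) z (v + w).
Proof.
move=> [p [q [-> q0 ->]]] [p' [q' [-> q0' ->]]].
exists (p * q' + p' * q), (q * q'); split.
- rewrite tofracD !tofracM.
  by apply: addf_div; [exact: ev_neq0 q0|exact: ev_neq0 q0'].
- by rewrite rmorphM hornerM mulf_neq0.
- by rewrite addf_div // rmorphD !rmorphM hornerD !hornerM.
Qed.

Lemma ZT_valueN f z v : ZT_value f z v -> ZT_value (- f) z (- v).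
Proof.
move=> [p [q [-> q0 ->]]]; exists (- p), q; split=> //.
  by rewrite tofracN mulNr.
by rewrite rmorphN hornerN mulNr.
Qed.

Lemma ZT_valueM f g z v w :
  ZT_value f z v -> ZT_value g z w -> ZT_value (f * g) z (v * w).
Proof.
move=> [p [q [-> q0 ->]]] [p' [q' [-> q0' ->]]].
exists (p * p'), (q * q'); split.
- by rewrite !tofracM; exact: mulf_div.
- by rewrite rmorphM hornerM mulf_neq0.
- by rewrite mulf_div !rmorphM !hornerM.
Qed.

Lemma ZT_valueV f z v : v != 0 -> ZT_value f z v ->
    ZT_value (f^-1)%R z (v^-1)%R.
Proof.
move=> v0 [p [q [-> q0 ve]]]; exists q, p; split.
- exact: invf_div.
- by move: v0; rewrite ve mulf_eq0 => /norP[].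
- by rewrite ve invf_div.
Qed.

Lemma ZT_value_neq0 f z v : v != 0 -> ZT_value f z v -> f != 0.
Proof.
move=> v0 fv; apply: contraNneq v0 => f0; move: fv; rewrite f0 => fv.
by rewrite (ZT_value_uniq fv (ZT_value0 z)).
Qed.

Lemma ZT_value_sum (I : Type) (r : seq I) (P : pred I)
    (F : I -> ZT) (f : I -> C) z :
  (forall i, P i -> ZT_value (F i) z (f i)) ->
  ZT_value (\sum_(i <- r | P i) F i) z (\sum_(i <- r | P i) f i).
Proof.
move=> H; elim/big_rec2 : _; first exact: ZT_value0.
by move=> i y1 y2 Pi; apply: ZT_valueD; exact: H.
Qed.

Lemma ZT_value_prod (I : Type) (r : seq I) (P : pred I)
    (F : I -> ZT) (f : I -> C) z :
  (forall i, P i -> ZT_value (F i) z (f i)) ->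
  ZT_value (\prod_(i <- r | P i) F i) z (\prod_(i <- r | P i) f i).
Proof.
move=> H; elim/big_rec2 : _; first exact: ZT_value1.
by move=> i y1 y2 Pi; apply: ZT_valueM; exact: H.
Qed.

Lemma ZT_value_sign (b : nat) z : ZT_value ((-1) ^+ b) z ((-1) ^+ b).
Proof.
by rewrite -signr_odd -[(-1) ^+ b in X in ZT_value _ _ X]signr_odd;
  case: odd; rewrite ?expr0 ?expr1; [apply: ZT_valueN|]; exact: ZT_value1.
Qed.

Lemma ZT_value_det n (A : 'M[ZT]_n) (a : 'M[C]_n) z :
  (forall i j, ZT_value (A i j) z (a i j)) -> ZT_value (\det A) z (\det a).
Proof.
move=> H; apply: ZT_value_sum => s _; apply: ZT_valueM;
  first exact: ZT_value_sign.
by apply: ZT_value_prod => i _.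
Qed.

(** Cramer's rule: the entries of the inverse are cofactors over the
    determinant. *)
Lemma regular_invmx n (A : 'M[ZT]_n) (a : 'M[C]_n) z :
  (forall i j, ZT_value (A i j) z (a i j)) -> \det a != 0 ->
  A \in unitmx /\ forall i j, regular_at (invmx A i j) z.
Proof.
move=> H d0; have dA := ZT_value_det H.
have uA : A \in unitmx by rewrite unitmxE unitfE (ZT_value_neq0 d0 dA).
split=> // i j; rewrite /invmx uA !mxE.
eexists; apply: ZT_valueM; first exact: ZT_valueV dA.
rewrite /cofactor; apply: ZT_valueM; first exact: ZT_value_sign.
by apply: (@ZT_value_det _ _ (row' j (col' i a))) => k l; rewrite !mxE;
  exact: H.
Qed.

(** Both regularity and the value persist near a point of regularity, by
    continuity of one representing fraction. *)
Lemma ZT_value_near f z v (e : R) : ZT_value f z v -> 0 < e ->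
  \forall x \near (z : C^o), regular_at f x /\ normc (v - ZT_eval f x) < e.
Proof.
move=> [p [q [fE q0 ->]]] e0.
have eC : (0 : C) < e%:C%C by rewrite ltcR.
have H := @horner_near_neq0 C (map_poly intr q) z q0.
have H' := @horner_div_near C (map_poly intr p) (map_poly intr q) z _ q0 eC.
have FF := nbhs_filter (z : C^o).
apply: filterS2 H H' => x qx; rewrite ltcR => xe.
have fx : ZT_value f x (ev p x / ev q x) by exists p, q.
by split; [eexists; exact: fx|rewrite (ZT_value_eval fx)].
Qed.

Lemma ZT_value_near_lt f z v (e : R) : ZT_value f z v -> normc v < e ->
  \forall x \near (z : C^o), normc (ZT_eval f x) < e.
Proof.
move=> fv ve; have e0 : 0 < e - normc v by rewrite subr_gt0.
have FF := nbhs_filter (z : C^o).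
apply: filterS (ZT_value_near fv e0) => x [_ xe].
have -> : ZT_eval f x = v + - (v - ZT_eval f x) by rewrite opprB addrC subrK.
apply: le_lt_trans (normcD _ _) _; rewrite normc_opp.
by rewrite addrC -ltrBrDr.
Qed.

(** The numerator of the difference has a neighbourhood of roots. *)
Lemma ZT_eq_near f g z :
  (\forall x \near (z : C^o),
     [/\ regular_at f x, regular_at g x & ZT_eval f x = ZT_eval g x]) -> f = g.
Proof.
move=> H; have FF := nbhs_filter (z : C^o).
have /= [[vf fv] [vg gv] _] := nbhs_singleton H.
have [p [q [dE q0 _]]] := ZT_valueD fv (ZT_valueN gv).
have H' := @horner_near_neq0 C (map_poly intr q) z q0.
have p0 : p = 0.
  apply: (map_inj_poly (f := intr : int -> C)) => //; first exact: intr_inj.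
  rewrite rmorph0; apply: (@poly_eq0_near C _ z).
  apply: filterS2 H H' => x [fx gx fgx] qx.
  have := ZT_valueD (regular_value fx) (ZT_valueN (regular_value gx)).
  rewrite fgx subrr dE => d0.
  have : ev p x / ev q x = 0 by apply: ZT_value_uniq d0; exists p, q.
  by move=> /eqP; rewrite mulf_eq0 invr_eq0 (negPf qx) orbF => /eqP.
by apply/eqP; rewrite -subr_eq0 dE p0 tofrac0 mul0r.
Qed.

(** All transition weights are built from powers of [T], which are 1 at
    [T = 1]. *)
Lemma ZT_value_Tpow (k : int) : ZT_value (Tvar ^ k) (1 : C) 1.
Proof.
have Tn n : ZT_value (Tvar ^+ n) (1 : C) 1.
  elim: n => [|n IH]; first exact: ZT_value1.
  by rewrite exprS -(mulr1 (1 : C)); apply: ZT_valueM; rewrite ?mulr1//;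
    exact: ZT_valueT.
case: k => n; first exact: Tn.
rewrite NegzE -(invr1 C).
by have := ZT_valueV (oner_neq0 C) (Tn n.+1); rewrite invr1.
Qed.

End RationalValues.

(** * Weighted sums over paths *)

Lemma ler_sum_subseq (K : numDomainType) (I : eqType) (r r' : seq I)
    (F : I -> K) :
  uniq r -> {subset r <= r'} -> (forall i, 0 <= F i) ->
  \sum_(i <- r) F i <= \sum_(i <- r') F i.
Proof.
move=> + + F0; elim: r r' => [|x r IH] r' /=.
  by move=> _ _; rewrite big_nil sumr_ge0.
move=> /andP[xr ur] sub.
rewrite big_cons [leRHS](big_rem x) ?sub ?mem_head//= lerD2l.
apply: IH => // y yr; have yx : y != x by apply: contraNneq xr => <-.
by move: (sub y); rewrite inE yr orbT (perm_mem (perm_to_rem (sub x (mem_head _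
  _)))) inE (negPf yx); exact.
Qed.

Lemma half_pow_small (K : archiRealFieldType) (c e : K) : 0 < e ->
  exists N, c * 2^-1 ^+ N < e.
Proof.
move=> e0; have [c0|c0] := leP c 0.
  by exists 0; rewrite mulr1; exact: le_lt_trans c0 e0.
exists (Num.bound (c / e)); rewrite exprVn ltr_pdivrMr ?exprn_gt0//.
rewrite mulrC -ltr_pdivrMr//.
apply: lt_trans (archi_boundP _) _; first by rewrite divr_ge0 ?ltW.
by rewrite -natrX ltr_nat ltn_expl.
Qed.

Section Paths.
Variables (S : choiceType) (E : seq S).
Hypothesis uE : uniq E.

(** Walks are enumerated by length, without asking that transitions be nonzero:
    a path using a zero transition has weight 0. *)
Fixpoint paths (m : nat) (s : S) : seq (seq S) :=
  if m is m'.+1 then [seq s :: w | u <- E, w <- paths m' u] else [:: [:: s]].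

Lemma mem_paths m s w :
  (w \in paths m s) =
  [&& ohead w == Some s, size w == m.+1 & all [in E] (behead w)].
Proof.
elim: m s w => [|m IH] s [|x w] //=.
- rewrite inE eqseq_cons andbC; case: w => //=; last by rewrite andbF.
  by rewrite andbT; apply/eqP/eqP => [->|[]].
- by apply/negP => /allpairsPdep[u [w [_ _]]].
- apply/allpairsPdep/idP => [[u [w' [uE' + [-> ->]]]]|].
    rewrite IH eqxx /=; case: w' => //= y w' /and3P[/eqP[->] /eqP[->] ->].
    by rewrite uE' eqxx.
  case: w => [|u w]; rewrite ?andbF//= => /and4P[/eqP[->] wm uE' wE].
  by exists u, (u :: w); split=> //; rewrite IH /= eqxx -eqSS wm wE.
Qed.

Lemma uniq_paths m s : uniq (paths m s).
Proof.
elim: m s => [|m IH] s //=.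
apply: allpairs_uniq_dep => //=.
move=> [u w] [u' w'] /allpairsPdep[v [p [_ + [-> ->]]]] /allpairsPdep[v' [p' [_
  + [-> ->]]]].
rewrite !mem_paths /= => /andP[/eqP hp _] /andP[/eqP hp' _] [pp'].
by move: hp; rewrite pp' hp' => -[->].
Qed.

Lemma last_paths m s w : w \in paths m s -> s \in E -> last s w \in E.
Proof.
rewrite mem_paths; case: w => //= x w /and3P[/eqP[->] _ wE] sE.
by have := mem_last s w; rewrite inE => /predU1P[->//|/(allP wE)].
Qed.

Section Weights.
Variable K : comNzRingType.
Implicit Types (a : S -> S -> K) (phi : S -> K).

Fixpoint cweight a (w : seq S) : K :=
  match w with
  | s :: ((t :: _) as w') => a s t * cweight a w'
  | _ => 1
  end.

(** Entry [s] of [A^m phi]. *)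
Definition pathsum a phi m s :=
  \sum_(w <- paths m s) cweight a w * phi (last s w).

Lemma pathsum0 a phi s : pathsum a phi 0 s = phi s.
Proof. by rewrite /pathsum big_seq1 mul1r. Qed.

Lemma pathsumS a phi m s :
  pathsum a phi m.+1 s = \sum_(u <- E) a s u * pathsum a phi m u.
Proof.
rewrite /pathsum /= big_allpairs_dep; apply: eq_bigr => u _.
rewrite mulr_sumr [LHS]big_seq [RHS]big_seq; apply: eq_bigr => w.
rewrite mem_paths; case: w => //= x w /andP[/eqP[->] _].
by rewrite mulrA.
Qed.

Lemma pathsumD a phi psi m s :
  pathsum a (fun u => phi u + psi u) m s = pathsum a phi m s + pathsum a psi m
    s.
Proof. by rewrite -big_split; apply: eq_bigr => w _; rewrite mulrDr. Qed.

Lemma pathsumSr a phi m s :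
  pathsum a phi m.+1 s = pathsum a (fun v => \sum_(u <- E) a v u * phi u) m s.
Proof.
elim: m s => [|m IH] s.
  by rewrite pathsumS pathsum0; apply: eq_bigr => u _; rewrite pathsum0.
by rewrite pathsumS [RHS]pathsumS; apply: eq_bigr => u _; rewrite IH.
Qed.

Lemma eq_pathsum a phi psi m s : s \in E -> {in E, phi =1 psi} ->
  pathsum a phi m s = pathsum a psi m s.
Proof.
move=> sE H; rewrite /pathsum big_seq [RHS]big_seq; apply: eq_bigr => w ws.
by rewrite H// (last_paths ws).
Qed.

(** Substitute [g = e_t + A g] into itself [N] times. *)
Lemma neumann a (g : S -> K) t N s : s \in E ->
  {in E, forall v, g v = (v == t)%:R + \sum_(u <- E) a v u * g u} ->
  g s = \sum_(0 <= m < N) pathsum a (fun v =>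
    (v == t)%:R) m s + pathsum a g N s.
Proof.
move=> sE Hg; elim: N => [|N ->]; first by rewrite big_geq// add0r pathsum0.
by rewrite big_nat_recr//= -addrA pathsumSr -pathsumD; congr (_ + _);
  exact: eq_pathsum.
Qed.
End Weights.
End Paths.

Section AbsSum.
Variables (R : realType) (S : choiceType) (E : seq S).
Hypothesis uE : uniq E.
Local Notation C := R[i].
Local Notation normc := Normc.normc.
Variables (a : S -> S -> C) (h : S -> R).
Hypothesis h0 : {in E, forall s, 0 < h s}.
Hypothesis lyap : {in E, forall s,
  \sum_(u <- E) normc (a s u) * h u <= h s * 2^-1}.

Lemma normc_cweight w : normc (cweight a w) = cweight (fun s t =>
    normc (a s t)) w.
Proof.
elim: w => [|s [|t w] IH]; rewrite ?Normc.normc1//=.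
by rewrite Normc.normcM IH.
Qed.

(** Iterating the inequality [|A| h <= h / 2]. *)
Lemma pathsum_le m s : s \in E ->
  pathsum E (fun s t => normc (a s t)) h m s <= h s * 2^-1 ^+ m.
Proof.
elim: m s => [|m IH] s sE; first by rewrite pathsum0 mulr1.
rewrite pathsumS exprS mulrA.
apply: le_trans (ler_wpM2r _ (lyap sE)); last by rewrite exprn_ge0.
rewrite mulr_suml big_seq [leRHS]big_seq; apply: ler_sum => u uE'.
by rewrite -mulrA ler_wpM2l ?normc_ge0// IH.
Qed.

Lemma pathsum_norm_le (g : S -> C) k m s : s \in E ->
  {in E, forall u, normc (g u) <= k * h u} ->
  normc (pathsum E a g m s) <= k * (h s * 2^-1 ^+ m).
Proof.
move=> sE gk; have k0 : 0 <= k.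
  by have := le_trans (normc_ge0 _) (gk _ sE); rewrite pmulr_lge0// h0.
apply: le_trans (normc_sum _ _ _) _.
apply: le_trans (ler_wpM2l k0 (pathsum_le m sE)).
rewrite mulr_sumr big_seq [leRHS]big_seq; apply: ler_sum => w ws.
rewrite Normc.normcM normc_cweight mulrCA ler_wpM2l// -?normc_cweight
  ?normc_ge0//.
by rewrite gk// (last_paths ws).
Qed.

Lemma pathsum_last_le m s t : s \in E -> t \in E ->
  \sum_(w <- paths E m s | last s w == t) normc (cweight a w)
    <= h s / h t * 2^-1 ^+ m.
Proof.
move=> sE tE; rewrite mulrAC ler_pdivlMr ?h0//.
apply: le_trans (pathsum_le m sE).
rewrite mulr_suml [leRHS](bigID (fun w =>
  last s w == t))/= -[leLHS]addr0 lerD//.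
  by apply: ler_sum => w /eqP ->; rewrite normc_cweight.
rewrite big_seq_cond sumr_ge0// => w /andP[ws _].
by rewrite mulr_ge0// -?normc_cweight ?normc_ge0// ltW// h0// (last_paths ws).
Qed.

Lemma geo_le n k : \sum_(k <= m < n) (2^-1 : R) ^+ m <= 2 * 2^-1 ^+ k.
Proof.
have [nk|kn] := leqP n k; first by rewrite big_geq// mulr_ge0.
rewrite (eq_bigr (fun m => - 2 * 2^-1 ^+ m.+1 - - 2 * 2^-1 ^+ m)).
  rewrite telescope_sumr ?(ltnW kn)//.
  have : 0 <= (2^-1 : R) ^+ n by rewrite exprn_ge0.
  by move: (_ ^+ n) (_ ^+ k) => x y; lra.
by move=> m _; rewrite exprS; field.
Qed.

(** The paths with more than [N] states form the tail of a geometric series. *)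
Lemma tail_le (r : seq (seq S)) s t N : s \in E -> t \in E -> uniq r ->
  {in r, forall w, [/\ (N < size w)%N,
    w \in paths E (size w).-1 s & last s w = t]} ->
  \sum_(w <- r) normc (cweight a w) <= 2 * (h s / h t) * 2^-1 ^+ N.
Proof.
move=> sE tE ur Hr.
pose M := \max_(w <- r) size w.
pose L := flatten [seq [seq w <- paths E m s | last s w == t] | m <- index_iota
  N M].
have sub : {subset r <= L}.
  move=> w wr; have [Nw wp wt] := Hr _ wr.
  apply/flattenP; exists [seq w <- paths E (size w).-1 s | last s w == t].
    apply/mapP; exists (size w).-1 => //; rewrite mem_index_iota.
    have w0 : (0 < size w)%N by apply: leq_ltn_trans Nw.
    by rewrite -ltnS !prednK// Nw /=; exact: leq_bigmax_seq.
  by rewrite mem_filter wt eqxx.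
apply: le_trans (ler_sum_subseq ur sub (fun w => normc_ge0 _)) _.
rewrite big_flatten big_map.
apply: (@le_trans _ _ (\sum_(N <= m < M) h s / h t * 2^-1 ^+ m)).
  by apply: ler_sum => m _; rewrite big_filter; exact: pathsum_last_le.
rewrite -mulr_sumr.
have hst : 0 <= h s / h t by rewrite divr_ge0// ltW// h0.
by apply: le_trans (ler_wpM2l hst (geo_le _ _)) _; rewrite mulrCA mulrA.
Qed.

(** The partial sum over all walks with at most [N] states is the Neumann sum,
    at distance [O(2^-N)] from [g s]; any further finite set of walks adds at
    most a geometric tail. *)
Lemma abs_sum_paths (s t : S) (g : S -> C) (W : set (seq S)) (f : seq S -> C) :
  s \in E -> t \in E ->
  {in E, forall v, g v = (v == t)%:R + \sum_(u <- E) a v u * g u} ->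
  (forall w, W w -> [/\ w \in paths E (size w).-1 s, last s w = t,
                       (0 < size w)%N & f w = cweight a w]) ->
  (forall m w, w \in paths E m s -> last s w = t -> ~ W w -> cweight a w = 0) ->
  abs_sum W f (g s).
Proof.
move=> sE tE Hg HW HnW.
have tail (F : {fset seq S}) N : [set` F] `<=` W ->
    \sum_(w <- enum_fset F | (N < size w)%N) normc (f w) <= 2 * (h s / h t) *
      2^-1 ^+ N.
  move=> FW; rewrite -big_filter.
  have FW' w : w \in [seq w <- enum_fset F | (N < size w)%N] -> W w /\
      (N < size w)%N.
    by rewrite mem_filter => /andP[-> wF]; split=> //; apply: FW.
  rewrite (eq_big_seq (fun w => normc (cweight a w))); last first.
    by move=> w /FW'[/HW[_ _ _ ->]].
  apply: (tail_le sE tE); first by rewrite filter_uniq ?fset_uniq.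
  by move=> w /FW'[/HW[wp wt _ _] Nw].
split.
  rewrite /summable; apply: (@le_lt_trans _ _ (2 * (h s / h t))%:E);
    last exact: ltry.
  apply: ge_ereal_sup => _ /= [A [fA AW] <-].
  rewrite fsbig_finite//=.
  rewrite (eq_bigr (fun w => (normc (f w))%:E)); last first.
    by move=> w _; rewrite /= ger0_norm ?normc_ge0.
  rewrite sumEFin lee_fin.
  have AW' : [set` fset_set A] `<=` W by rewrite fset_setK.
  have := tail _ 0 AW'; rewrite expr0 mulr1; apply: le_trans.
  rewrite [leLHS]big_seq_cond [leRHS]big_seq_cond le_eqVlt; apply/orP; left;
    apply/eqP.
  apply: eq_bigl => w; rewrite andbT; case: (boolP (w \in _)) => //= wA.
  by have [_ _ ->] := HW _ (AW' _ wA).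
move=> e e0.
pose k := \sum_(u <- E) normc (g u) / h u.
have gk : {in E, forall u, normc (g u) <= k * h u}.
  move=> u uE'; rewrite -ler_pdivrMr ?h0// /k (big_rem u uE')/= lerDl.
  rewrite big_seq sumr_ge0// => v /mem_rem vE.
  by rewrite divr_ge0 ?normc_ge0// ltW// h0.
have [N HN] := half_pow_small (2 * (h s / h t) + k * h s) e0.
pose L := [seq w | m <- index_iota 0 N,
  w <- [seq w <- paths E m s | last s w == t]].
have memL w : (w \in L) = [&& (0 < size w <= N)%N,
    w \in paths E (size w).-1 s & last s w == t].
  apply/allpairsPdep/idP => [[m [w' [mN + ->]]]|/and3P[/andP[w0 wN] wp wt]].
    rewrite mem_filter => /andP[-> wp]; rewrite andbT.
    have := wp; rewrite mem_paths => /and3P[_ /eqP sw _].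
    by rewrite sw wp andbT; move: mN; rewrite mem_index_iota.
  exists (size w).-1, w; split=> //; first by rewrite mem_index_iota /= prednK.
  by rewrite mem_filter wt.
have uL : uniq L.
  apply: allpairs_uniq_dep => [|m _|]; first exact: iota_uniq.
    by rewrite filter_uniq ?uniq_paths.
  move=> [m w] [m' w'] /allpairsPdep[v [p [_ + [-> ->]]]] /allpairsPdep[v' [p'
    [_ + [-> ->]]]].
  rewrite !mem_filter !mem_paths /= =>
    /and4P[_ _ /eqP hp _] /and4P[_ _ /eqP hp' _] pp'.
  by move: hp; rewrite pp' hp' => -[->].
pose F0 := [fset w in L | `[< W w >]]%fset.
(* Then [F] exceeds [F0] by walks with more than [N] states only. *)
exists F0; first by move=> w /=; rewrite !inE => /andP[_ /asboolP].
move=> F F0F FW.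
have sumL : \sum_(w <- enum_fset F | (size w <= N)%N) f w = \sum_(0 <= m < N)
    pathsum E a (fun v => (v == t)%:R) m s.
  transitivity (\sum_(w <- L) cweight a w); last first.
    rewrite big_allpairs_dep; apply: eq_bigr => m _.
    rewrite big_filter big_mkcond; apply: eq_bigr => w _.
    by case: eqP => _; rewrite ?mulr1 ?mulr0.
  rewrite [RHS](bigID (fun w => `[< W w >]))/= [X in _ + X]big1_seq ?addr0;
    last first.
    move=> w /andP[/asboolP nW]; rewrite memL => /and3P[_ wp /eqP wt].
    exact: HnW wp wt nW.
  rewrite -big_filter -[RHS]big_filter;
    transitivity (\sum_(w <- [seq w <- L | `[< W w >]]) f w).
    apply: perm_big; apply: uniq_perm; rewrite ?filter_uniq ?fset_uniq// => w.
    rewrite !mem_filter; apply/andP/andP => [[wN wF]|[/asboolP Ww wL]].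
      have Ww := FW _ wF; have [wp /eqP wt w0 _] := HW _ Ww.
      by split; [exact/asboolP|rewrite memL w0 wN wp].
    split; first by move: wL; rewrite memL => /and3P[/andP[]].
    by apply: F0F; rewrite /= !inE wL; exact/asboolP.
  apply: eq_big_seq => w; rewrite mem_filter => /andP[/asboolP Ww _].
  by have [_ _ _ ->] := HW _ Ww.
rewrite (bigID (fun w => (size w <= N)%N))/= sumL (neumann N sE Hg) addrAC
  opprD addrA subrr sub0r.
apply: le_lt_trans HN; rewrite addrC mulrDl.
apply: le_trans (normcD _ _) _; rewrite lerD//.
  apply: le_trans (normc_sum _ _ _) _.
  rewrite (eq_bigl (fun w : seq S => (N < size w)%N)); first exact: tail.
  by move=> w; rewrite ltnNge.
by rewrite normc_opp -mulrA; exact: pathsum_norm_le.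
Qed.
End AbsSum.

Lemma abs_sum_unique (R : realType) (I : choiceType) (A : set I) 
    (f : I -> R[i]) v w :
  abs_sum A f v -> abs_sum A f w -> v = w.
Proof.
move=> [_ Hv] [_ Hw]; apply/eqP; rewrite -subr_eq0; apply/eqP/Normc.eq0_normc.
apply/eqP; rewrite eq_le normc_ge0 andbT; apply/ler_addgt0Pl => e e0;
  rewrite addr0.
have e2 : 0 < e / 2 by rewrite divr_gt0.
have [F1 F1A H1] := Hv _ e2; have [F2 F2A H2] := Hw _ e2.
have FA : [set` (F1 `|` F2)%fset] `<=` A.
  by move=> x /=; rewrite inE => /orP[]; [apply: F1A|apply: F2A].
have {}H1 := H1 (F1 `|` F2)%fset _ FA; have {}H2 := H2 (F1 `|` F2)%fset _ FA.
set x := \sum_(i <- _) _ in H1 H2.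
have -> : v - w = - (x - v) + (x - w) by rewrite opprB addrA subrK.
apply: le_trans (normcD _ _) _; rewrite normc_opp (splitr e) lerD// ltW//.
  by apply: H1 => i /=; rewrite inE => ->.
by apply: H2 => i /=; rewrite inE orbC => ->.
Qed.

(** * The Green's function of a chain that is triangular at T = 1 *)

Lemma near_all (T : Type) (F : set_system T) (I : eqType) (r : seq I)
    (P : I -> T -> Prop) : Filter F ->
  (forall i, i \in r -> \forall z \near F, P i z) ->
  \forall z \near F, forall i, i \in r -> P i z.
Proof.
move=> FF; elim: r => [|i r IH] H; first exact: nearW.
have Hi := H i (mem_head _ _).
have /IH Hr j : j \in r -> \forall z \near F, P j z.
  by move=> jr; apply: H; rewrite inE jr orbT.
apply: filterS2 Hi Hr => z Hi Hr j; rewrite inE => /predU1P[->//|]; exact: Hr.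
Qed.

Section Lyapunov.
Variables (R : realType) (S : choiceType) (E : seq S) (rho : S -> R).
Variable a : S -> S -> R.
Hypothesis a0 : forall s t, 0 <= a s t.
Hypothesis arho : {in E &, forall s t, a s t != 0 -> rho s < rho t}.

(** With [h u = d ^ r u], [r u] the number of states below [u], every nonzero
    transition gains a factor [d], which beats the entries of [a] when [d] is
    small.  The thresholds [k] leave room to replace [a] by a perturbation [b]
    while keeping the same [h]. *)
Lemma lyapunov : exists h : S -> R, exists2 k : S -> S -> R,
  (forall s, 0 < h s) /\ {in E &, forall s u, a s u < k s u} &
  forall b : S -> S -> R, {in E &, forall s u, b s u <= k s u} ->
  {in E, forall s, \sum_(u <- E) b s u * h u <= h s * 2^-1}.
Proof.
pose r s := count (fun u => rho u < rho s) E.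
have r_lt s t : s \in E -> rho s < rho t -> (r s < r t)%N.
  move=> sE st; rewrite /r !(permP (perm_to_rem sE)) /= ltxx st add0n add1n
    ltnS.
  by apply: sub_count => u /= us; exact: lt_trans us st.
pose c := \sum_(s <- E) \sum_(u <- E) a s u.
have ac : {in E &, forall s u, a s u <= c}.
  move=> s u sE uE; rewrite /c (big_rem s sE)/= (big_rem u uE)/= -addrA lerDl.
  by rewrite addr_ge0// sumr_ge0// => *; exact: sumr_ge0.
have c0 : 0 <= c by rewrite sumr_ge0// => *; exact: sumr_ge0.
pose eps := (2 * (size E).+1%:R)^-1 : R.
have eps0 : 0 < eps by rewrite invr_gt0 mulr_gt0.
pose d := eps / (c + 1).
have c1 : 0 < c + 1 by rewrite ltr_wpDl.
have d0 : 0 < d by rewrite divr_gt0.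
have d1 : d <= 1.
  rewrite ler_pdivrMr// mul1r (@le_trans _ _ 1)// ?lerDr// invf_le1 ?mulr_gt0//.
  by rewrite -natrM ler1n.
pose h u := d ^+ r u.
have h0 u : 0 < h u by rewrite exprn_gt0.
exists h; exists (fun s u => eps * h s / h u).
  split=> // s u sE uE; rewrite ltr_pdivlMr//.
  have [->|asu] := eqVneq (a s u) 0; first by rewrite mul0r mulr_gt0.
  have ru := r_lt _ _ sE (arho sE uE asu).
  have hu : h u <= d * h s by rewrite -exprS ler_wiXn2l// ltW.
  apply: le_lt_trans (ler_wpM2l (a0 _ _) hu) _.
  rewrite mulrA ltr_pM2r// /d mulrCA gtr_pMr// ltr_pdivrMr// mul1r.
  by rewrite ltr_pwDr// ac.
move=> b bk s sE; rewrite -ler_pdivrMl//.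
apply: (@le_trans _ _ ((h s)^-1 * \sum_(u <- E) eps * h s)).
  rewrite ler_wpM2l ?invr_ge0 ?(ltW (h0 _))//.
  rewrite big_seq [leRHS]big_seq; apply: ler_sum => u uE.
  by rewrite -ler_pdivlMr// bk.
rewrite big_const_seq count_predT iter_addr_0 -mulrnAr mulrCA mulrnAr mulVf
  ?gt_eqF//.
rewrite /eps invfM -mulrA ger_pMr// -[leRHS](mulVf (x :=
  (size E).+1%:R)) ?pnatr_eq0//.
by rewrite ler_pM2l ?invr_gt0 ?ltr0n// ler_nat.
Qed.
End Lyapunov.

Lemma mem_states (S : choiceType) (M : markov_chain S) s :
  (s \in enum_fset (fset_set (states M))) = `[< states M s >].
Proof.
have := in_fset_set (states_finite M) s; rewrite /mem_set => ->.
by rewrite -topredE /=.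
Qed.

Lemma sum_substates (K : nmodType) (S : choiceType) (M N : markov_chain S)
    (F : S -> K) :
  states M `<=` states N -> (forall u, states N u -> ~ states M u -> F u = 0) ->
  \sum_(u <- enum_fset (fset_set (states N))) F u =
  \sum_(u <- enum_fset (fset_set (states M))) F u.
Proof.
move=> MN F0; rewrite (bigID (fun u =>
  u \in enum_fset (fset_set (states M))))/=.
rewrite [X in _ + X]big_seq_cond [X in _ + X]big1 ?addr0; last first.
  by move=> u; rewrite !mem_states => /andP[/asboolP Nu /asboolP nMu];
    exact: F0.
rewrite -big_filter; apply: perm_big; apply: uniq_perm;
  rewrite ?filter_uniq ?fset_uniq//.
move=> u; rewrite mem_filter !mem_states; apply/andP/idP => [[]//|/asboolP Mu].
by split; apply/asboolP => //; exact: MN.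
Qed.

Section Green.
Variables (R : realType) (S : choiceType) (M : markov_chain S) (rho : S -> R).
Local Notation C := R[i].
Local Notation normc := Normc.normc.
Local Notation E := (enum_fset (fset_set (states M))).
Hypothesis trans_regular : forall s t, states M s -> states M t ->
  regular_at (trans M s t) (1 : C).
Hypothesis trans_rho : forall s t, states M s -> states M t ->
  ZT_eval (trans M s t) (1 : C) != 0 -> rho s < rho t.

(** Column [t] of the equation [G = 1 + A G]. *)
Definition green_eqn (t : S) (x : S -> ZT) := forall s, states M s ->
  x s = (s == t)%:R + \sum_(u <- E) trans M s u * x u.

Let e (i : 'I_(size E)) : S := tnth (in_tuple E) i.
Let A : 'M[ZT]_(size E) := \matrix_(i, j) ((i == j)%:R - trans M (e i) (e j)).
Let a1 : 'M[C]_(size E) :=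
  \matrix_(i, j) ((i == j)%:R - ZT_eval (trans M (e i) (e j)) 1).

Let e_states i : states M (e i).
Proof. by apply/asboolP; rewrite -mem_states mem_tnth. Qed.

Let e_inj : injective e.
Proof.
move=> i j /eqP; rewrite /e !(tnth_nth (e i)) /= nth_uniq ?fset_uniq// => /eqP.
exact: val_inj.
Qed.

Let e_surj s : states M s -> exists i, s = e i.
Proof.
move=> /asboolP; rewrite -mem_states => /(tnthP (in_tuple E))[i ->].
by exists i.
Qed.

Let sum_e (V : nmodType) (F : S -> V) : \sum_(u <- E) F u = \sum_i F (e i).
Proof. exact: big_tnth. Qed.

Let det_a1 : \det a1 != 0.
Proof.
apply/negP => /det0P[v v0 va].
have /rV0Pn[j0 vj0] := v0.
have /= [j vj jmin] := @arg_minP _ R _ j0 (fun j => v 0 j != 0) (fun j =>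
    rho (e j)) vj0.
have := congr1 (fun w : 'rV_(size E) => w 0 j) va; rewrite !mxE.
under eq_bigr do rewrite mxE mulrBr.
rewrite sumrB (bigD1 j)//= eqxx mulr1 big1 ?addr0; last first.
  by move=> i ij; rewrite (negPf ij) mulr0.
rewrite big1 ?subr0; last first.
  move=> i _; apply/eqP; rewrite mulf_eq0.
  have [//|vi /=] := eqVneq (v 0 i) 0.
  have [//|aij] := eqVneq (ZT_eval (trans M (e i) (e j)) (1 : C)) 0.
  have := trans_rho (e_states _) (e_states _) aij.
  by rewrite ltNge jmin.
by move=> /eqP; rewrite (negPf vj).
Qed.

Let A_value i j : ZT_value (A i j) 1 (a1 i j).
Proof.
rewrite !mxE; apply: ZT_valueD; first by case: (i == j);
  [exact: ZT_value1|exact: ZT_value0].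
exact/ZT_valueN/regular_value/trans_regular.
Qed.

(** [1 - A] is invertible because its value at 1 is: if [v = v A(1)] with [v]
    nonzero, a nonzero entry of [v] at a state of minimal [rho] would have to come
    from a state with smaller [rho].  The last clause is the formula
    [x = (1 - A)^-1 b], which also contains the uniqueness of solutions. *)
Lemma green_eqn_solution : exists G : S -> S -> ZT,
  [/\ forall s t, states M s -> states M t -> regular_at (G s t) (1 : C),
      forall t, states M t -> green_eqn t (G^~ t) &
      forall x b : S -> ZT,
        (forall s, states M s -> x s = b s + \sum_(u <- E) trans M s u * x u) ->
        forall s, states M s -> x s = \sum_(u <- E) G s u * b u].
Proof.
have [uA rA] := regular_invmx A_value det_a1.
pose idx s := [pick i | e i == s].
have idxe i : idx (e i) = Some i.
  by rewrite /idx; case: pickP => [j /eqP/e_inj->//|/(_ i)]; rewrite eqxx.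
pose G s t := if idx s is Some i then if idx t is Some j then invmx A i j else
  0 else 0.
have Ge i j : G (e i) (e j) = invmx A i j by rewrite /G !idxe.
have eqnP x b : (forall s, states M s ->
    x s = b s + \sum_(u <- E) trans M s u * x u) <->
    A *m (\col_i x (e i)) = \col_i b (e i).
  have rowA i : (A *m (\col_i x (e i))) i 0 = x (e i) - \sum_(u <- E) trans M
      (e i) u * x u.
    rewrite !mxE; under eq_bigr do rewrite !mxE mulrBl.
    rewrite sumrB sum_e (bigD1 i)//= eqxx mul1r big1 ?addr0// => j ji.
    by rewrite eq_sym (negPf ji) mul0r.
  split=> H; first by apply/colP => i;
    rewrite rowA (H _ (e_states i)) addrK mxE.
  move=> _ /e_surj[i ->]; have := rowA i; rewrite H mxE => ->.
  by rewrite subrK.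
exists G; split.
- by move=> _ _ /e_surj[i ->] /e_surj[j ->]; rewrite Ge.
- move=> _ /e_surj[j ->]; apply/(eqnP _ (fun s => (s == e j)%:R)).
  rewrite (_ : \col_i G _ _ = invmx A *m delta_mx j 0).
    by rewrite mulKVmx//; apply/colP => i; rewrite !mxE (inj_eq e_inj) andbT.
  by apply/colP => i; rewrite mxE Ge -colE mxE.
- move=> x b /eqnP H _ /e_surj[i ->].
  have := congr1 (fun w : 'cV_(size E) => (invmx A *m w) i 0) H.
  rewrite mulKmx// !mxE sum_e => ->; apply: eq_bigr => j _.
  by rewrite Ge mxE.
Qed.

Lemma weight_value (a : S -> S -> C) z w :
  (forall s t, states M s -> states M t -> ZT_value (trans M s t) z (a s t)) ->
  (forall x, x \in w -> states M x) -> ZT_value (weight M w) z (cweight a w).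
Proof.
move=> Ha; elim: w => [|s [|t w] IH] Hw; [exact: ZT_value1|exact: ZT_value1|].
apply: ZT_valueM.
  by apply: Ha; apply: Hw; rewrite !inE eqxx ?orbT.
by apply: IH => x xw; apply: Hw; rewrite inE xw orbT.
Qed.

Lemma unsorted_weight (a : S -> S -> C) w :
  (forall s t, trans M s t = 0 -> a s t = 0) ->
  ~~ sorted (fun x y => trans M x y != 0) w -> cweight a w = 0.
Proof.
move=> Ha; elim: w => [|s [|t w] IH] //=.
rewrite negb_and negbK => /orP[/eqP/Ha->|/IH/= ->]; first by rewrite mul0r.
by rewrite mulr0.
Qed.

Lemma regular_near (f : ZT) : regular_at f (1 : C) ->
    \forall z \near (1 : C^o), regular_at f z.
Proof.
move=> [v fv]; have FF := nbhs_filter (1 : C^o).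
by apply: filterS (ZT_value_near fv ltr01) => z [].
Qed.

Lemma near_states2 (P : S -> S -> C -> Prop) :
  (forall s t, states M s -> states M t -> \forall z \near (1 : C^o),
    P s t z) ->
  \forall z \near (1 : C^o), forall s t, states M s -> states M t -> P s t z.
Proof.
move=> H; have FF := nbhs_filter (1 : C^o).
have : \forall z \near (1 : C^o), forall s, s \in E -> forall t, t \in E ->
    P s t z.
  apply: (near_all FF) => s; rewrite mem_states => /asboolP Ms.
  by apply: (near_all FF) => t; rewrite mem_states => /asboolP; exact: H.
move=> H'; apply: filterS H' => z Hz s t Ms Mt; apply: Hz; rewrite mem_states;
  exact/asboolP.
Qed.

(** Any solution of [G = 1 + A G] regular at 1 is the sum over walks near 1; the
    weights of [lyapunov], found at [T = 1], serve on a whole neighbourhood. *)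
Lemma green_atP (G : S -> S -> ZT) :
  (forall s t, states M s -> states M t -> regular_at (G s t) (1 : C)) ->
  (forall t, states M t -> green_eqn t (G^~ t)) ->
  \forall z \near (1 : C^o), forall s t, states M s -> states M t ->
    green_at M s t (G s t) z.
Proof.
move=> rG eqnG; have FF := nbhs_filter (1 : C^o).
have memE s : s \in E -> states M s by rewrite mem_states => /asboolP.
have [|h [k [h0 ak] kb]] := @lyapunov R S E rho
    (fun s t => normc (ZT_eval (trans M s t) (1 : C))) (fun _ _ => normc_ge0 _).
  move=> s t /memE Ms /memE Mt st; apply: trans_rho => //.
  by apply: contraNneq st => ->; rewrite Normc.normc0.
have H1 : \forall z \near (1 : C^o), forall s t, states M s -> states M t ->
    [/\ regular_at (trans M s t) z, regular_at (G s t) z &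
        normc (ZT_eval (trans M s t) z) < k s t].
  apply: near_states2 => s t Ms Mt.
  have Es : s \in E by rewrite mem_states; exact/asboolP.
  have Et : t \in E by rewrite mem_states; exact/asboolP.
  have tv := regular_value (trans_regular Ms Mt).
  have N1 := ZT_value_near_lt tv (ak s t Es Et).
  have N2 := regular_near (trans_regular Ms Mt).
  have N3 := regular_near (rG _ _ Ms Mt).
  by apply: filterS3 N1 N2 N3.
apply: filterS H1 => z Hz s t Ms Mt.
have Es : s \in E by rewrite mem_states; exact/asboolP.
have Et : t \in E by rewrite mem_states; exact/asboolP.
pose a u v := ZT_eval (trans M u v) z.
have aP u v : states M u -> states M v -> ZT_value (trans M u v) z (a u v).
  by move=> Mu Mv; apply: regular_value; have [] := Hz _ _ Mu Mv.
split.
- by have [] := Hz _ _ Ms Mt.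
- by move=> w [Hw _ _ _]; eexists; exact: weight_value aP Hw.
- apply: (@abs_sum_paths R S E (fset_uniq _) a h _ _ s t (fun v =>
    ZT_eval (G v t) z)) => //.
  + apply: kb => u v /memE Mu /memE Mv; apply/ltW.
    by have [] := Hz _ _ Mu Mv.
  + move=> v /memE Mv; apply: ZT_value_eval; rewrite (eqnG t Mt v Mv).
    apply: ZT_valueD; first by case: eqP => _;
      [exact: ZT_value1|exact: ZT_value0].
    rewrite big_seq [\sum_(u <- E) a v u * _]big_seq.
    apply: ZT_value_sum => u /memE Mu; apply: ZT_valueM; first exact: aP.
    by apply: regular_value; have [] := Hz _ _ Mu Mt.
  + move=> w [Hw hw lw sw]; split=> //; last exact/ZT_value_eval/weight_value.
      rewrite mem_paths hw eqxx /=; case: w Hw hw {lw sw} => //= x w Hw _.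
      rewrite eqxx; apply/allP => u uw /=; rewrite mem_states; apply/asboolP/Hw.
      by rewrite inE uw orbT.
    by case: w hw {Hw lw sw}.
  + move=> m w; rewrite mem_paths => /and3P[/eqP hw sw wE] lw nW.
    apply: unsorted_weight.
      by move=> u v uv; rewrite /a uv; exact/ZT_value_eval/ZT_value0.
    apply/negP => srt; apply: nW; split=> // x.
    case: w hw wE {sw lw srt} => //= y w [->] wE; rewrite inE =>
      /predU1P[->//|xw].
    by apply: memE; exact: (allP wE).
Qed.

(** Sums over walks determine the values near 1, hence the rational function. *)
Lemma greenE (G : S -> S -> ZT) :
  (forall s t, states M s -> states M t -> regular_at (G s t) (1 : C)) ->
  (forall t, states M t -> green_eqn t (G^~ t)) ->
  forall s t, states M s -> states M t -> green R M s t = G s t.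
Proof.
move=> rG eqnG s t Ms Mt.
have FF := nbhs_filter (1 : C^o).
have GG : \forall z \near (1 : C^o), green_at M s t (G s t) z.
  by apply: filterS (green_atP rG eqnG) => z; exact.
apply: xget_unique => // g gG; apply: (@ZT_eq_near R _ _ 1).
apply: filterS2 gG GG => z [rg _ sg] [rG' _ sG]; split=> //.
exact: abs_sum_unique sg sG.
Qed.

(** Induction on the number of states above [s], through the equation
    [G = 1 + A G] at [T = 1]. *)
Lemma green_value1 (G : S -> S -> ZT) :
  (forall s t, states M s -> states M t -> regular_at (G s t) (1 : C)) ->
  (forall t, states M t -> green_eqn t (G^~ t)) ->
  forall s t, states M s -> states M t -> ZT_eval (G s t) (1 : C) != 0 ->
  s = t \/ rho s < rho t.
Proof.
move=> rG eqnG s t Ms Mt.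
have memE u : u \in E -> states M u by rewrite mem_states => /asboolP.
have [n] := ubnP (count (fun u => rho s < rho u) E).
elim: n s Ms => // n IH s Ms; rewrite ltnS => sn.
have -> : ZT_eval (G s t) (1 : C) =
    (s == t)%:R + \sum_(u <- E) ZT_eval (trans M s u) 1 * ZT_eval (G u t) 1.
  apply: ZT_value_eval; rewrite (eqnG t Mt s Ms).
  apply: ZT_valueD; first by case: eqP => _;
    [exact: ZT_value1|exact: ZT_value0].
  rewrite big_seq [X in ZT_value _ _ X]big_seq.
  apply: ZT_value_sum => u /memE Mu; apply: ZT_valueM; apply: regular_value;
    [exact: trans_regular|exact: rG].
have [->|st] := eqVneq s t; first by left.
rewrite add0r => nz; right.
have [u uE] : exists2 u, u \in E & ZT_eval (trans M s u) (1 : C) * ZT_eval (G u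
    t) 1 != 0.
  apply: contraPP nz => H; apply/negP; rewrite negbK; apply/eqP.
  rewrite big_seq big1// => u uE; apply/eqP/negPn/negP => nz.
  by apply: H; exists u.
rewrite mulf_eq0 negb_or => /andP[su ut].
have Mu := memE _ uE; have rsu := trans_rho Ms Mu su.
have [|ut'|] := IH u Mu _ ut; last exact: lt_trans.
  apply: leq_trans sn; rewrite !(permP (perm_to_rem uE)) /= ltxx rsu add0n
    add1n ltnS.
  by apply: sub_count => v /=; exact: lt_trans.
by rewrite -ut'.
Qed.
End Green.

(** * Strands as intervals of parameters *)

Lemma finite_isolated (R : realType) (F : set R) (x : R) : finite_set F ->
  exists2 e : R, 0 < e & forall y, `|x - y| < e -> y != x -> ~ F y.
Proof.
move=> /finite_seqP[r ->]; elim: r => [|z r [e e0 IH]]; first by exists 1.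
have [zx|zx] := eqVneq z x.
  by exists e => // y xy yx /=; rewrite inE => /predU1P[yz|];
    [rewrite yz zx eqxx in yx|exact: IH].
exists (Num.min e `|x - z|); first by rewrite lt_min e0 normr_gt0 subr_eq0
  eq_sym.
move=> y; rewrite lt_min => /andP[xe xz] yx /=; rewrite inE => /predU1P[yz|].
  by rewrite yz ltxx in xz.
exact: IH.
Qed.

Section Strands.
Variables (R : realType) (Sigma : set (plane R)) (D : tangle_diagram Sigma).
Hypothesis no_closed : forall k : component D, ~~ is_circle k.
Local Notation param := (component D * R)%type.
Implicit Types (x y : param) (k : component D) (s : set (plane R)).
Local Notation A := (diagram_set D `\` crossing_points D).

Lemma ptsE k t : pts (k, t) <-> 0 <= t <= 1.
Proof. by rewrite /pts /= (negPf (no_closed k)); split=> [[-> ->]|/andP[]]. Qed.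

Definition clear k t t' := forall r, (t <= r <= t') || (t' <= r <= t) ->
  ~ double_points (k, r).

Lemma clear_sym k t t' : clear k t t' -> clear k t' t.
Proof. by move=> H r rt; apply: H; rewrite orbC. Qed.

Lemma clear_l k t t' : clear k t t' -> ~ double_points (k, t).
Proof. by apply; rewrite lexx andbT /=; exact: le_total. Qed.

Lemma clear_r k t t' : clear k t t' -> ~ double_points (k, t').
Proof. by move/clear_sym/clear_l. Qed.

Lemma clear_trans k t t' t'' : clear k t t' -> clear k t' t'' -> clear k t t''.
Proof.
move=> H H' r /orP[]/andP[tr rt]; have [rt'|rt'] := leP r t'.
- by apply: H; rewrite tr rt'.
- by apply: H'; rewrite (ltW rt') rt.
- by apply: H'; rewrite rt' tr orbT.
- by apply: H; rewrite (ltW rt') rt orbT.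
Qed.

Lemma clear_refl k t : clear k t t <-> ~ double_points (k, t).
Proof.
split=> [|H r]; first by apply; rewrite lexx.
by rewrite orbb -eq_le => /eqP <-.
Qed.

(** There are finitely many double points. *)
Lemma double_isolated x : exists2 e : R, 0 < e &
  forall t, `|x.2 - t| < e -> t != x.2 -> ~ double_points (x.1, t).
Proof.
case: x => k t /=; apply: (@finite_isolated _ [set r | double_points (k, r)]).
apply: (@sub_finite_set _ _ (snd @` @double_points R D)).
  by move=> r Fr; exists (k, r).
exact/finite_image/(double_finite (tangle_axiomsP D)).
Qed.

Lemma clear_near k t : ~ double_points (k, t) -> exists2 e : R, 0 < e &
  forall t', `|t - t'| < e -> clear k t t'.
Proof.
move=> nt; have [e e0 He] := double_isolated (k, t).
exists e => // t' tt' r tr; have [->//|rt] := eqVneq r t.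
apply: He => //=; apply: le_lt_trans tt'.
by case/orP: tr => /andP[tr rt']; [rewrite !ler0_norm ?subr_le0 ?(le_trans
  tr)//|
  rewrite !ger0_norm ?subr_ge0 ?(le_trans tr)//]; lra.
Qed.

Lemma param_unique x y : pts x -> pts y -> point_of x = point_of y ->
  ~ double_points x -> x = y.
Proof.
move=> px py xy nx; apply/eqP/negPn/negP => /eqP ne; apply: nx.
by split=> //; exists y; split=> // yx; apply: ne.
Qed.

Lemma curve_A k t : pts (k, t) -> A (curve k t) <-> ~ double_points (k, t).
Proof.
move=> pt; split=> [[_ nc] dt|nd]; first by apply: nc; exists (k, t).
split; first by exists (k, t).
move=> [y dy ye]; apply: nd; have [yk|/eqP yk] := eqVneq y (k, t);
  first by rewrite -yk.
split=> //; exists y; split=> //; by case: dy.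
Qed.

Lemma image_closed k (B : set R) : B `<=` [set t | pts (k, t)] -> closed B ->
  closed (curve k @` B).
Proof.
move=> Bp cB; apply: compact_closed; first exact: norm_hausdorff.
apply: continuous_compact.
  apply: continuous_in_subspaceT => u /set_mem/Bp pu.
  exact: (@curve_continuous _ _ D (k, u)).
apply: (@subclosed_compact _ B `[0, 1]%classic) => //;
  first exact: segment_compact.
by move=> t /Bp /ptsE; rewrite /= in_itv.
Qed.

Lemma closedP_real (B : set R) :
  (forall u, ~ B u -> exists2 e, 0 < e & forall v, `|u - v| < e -> ~ B v) ->
    closed B.
Proof.
move=> H u clx; apply: contrapT => /H[e e0 He].
have [v [Bv uv]] := clx (ball u e) (nbhsx_ballx u e e0).
exact: He uv Bv.
Qed.

(** The parameters clear from [t], together with the double points, form a closed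
    set [J] of reals, and so do the parameters that are not clear from [t].
    The image [K1] of the first set and the image [K2] of the second, together
    with all other components, are closed and complementary in the diagram
    minus its crossings, so a connected subset meeting [K1] stays in [K1]. *)
Lemma connected_clear (Cn : set (plane R)) k t k' t' :
  connected Cn -> Cn `<=` A -> pts (k, t) -> pts (k', t') ->
  Cn (curve k t) -> Cn (curve k' t') -> k = k' /\ clear k t t'.
Proof.
move=> cC CA pt pt' Ct Ct'.
have nt : ~ double_points (k, t) by apply/(curve_A pt)/CA.
have nt' : ~ double_points (k', t') by apply/(curve_A pt')/CA.
pose J : set R := [set r : R | clear k t r \/ double_points (k, r)].
pose N : set R := [set r : R | ~ clear k t r].
pose I01 : set R := `[0, 1]%classic.
have I_pts (j' : component D) (r' : R) : I01 r' <-> pts (j', r').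
  by split=> [h|/ptsE h]; [apply/ptsE; move: h|move: h]; rewrite /I01 /= in_itv.
have cl_I (B : set R) : closed B -> forall k0, closed (curve k0 @` (B `&` I01)).
  move=> cB k0; apply: image_closed; last by apply: closedI => //;
    exact: interval_closed.
  by move=> r [_ /(I_pts k0)].
have cJ : closed J.
  apply: closedP_real => r /not_orP[ntr nr]; have [e e0 He] := clear_near nr.
  exists e => // r' /He rr' [tr'|]; first by apply: ntr;
    exact: clear_trans tr' (clear_sym rr').
  exact: clear_r rr'.
have cN : closed N.
  apply: closedP_real => r /contrapT tr.
  have nr : ~ double_points (k, r) by exact: clear_r tr.
  have [e e0 He] := clear_near nr.
  by exists e => // r' /He rr'; apply; exact: clear_trans tr rr'.
pose K1 := curve k @` (J `&` I01).
pose K2 := curve k @` (N `&` I01) `|`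
  \bigcup_(j in [set j : component D | j != k]) curve j @` (setT `&` I01).
have cK1 : closed K1 by exact: cl_I.
have cK2 : closed K2.
  apply: closedU; first exact: cl_I.
  by apply: closed_bigcup => [|j _]; [exact: finite_finset|apply: cl_I;
    exact: closedT].
have K12 p : A p -> K1 p <-> ~ K2 p.
  move=> Ap; have [[[j r] pr rp] _] := Ap.
  have nr : ~ double_points (j, r) by apply/(curve_A pr); move: Ap; rewrite -rp.
  have uniqp (j' : component D) (r' : R) : pts (j', r') -> curve j' r' = p ->
      (j', r') = (j, r).
    by move=> pr' rp'; apply/esym/param_unique => //;
      rewrite /point_of /= rp' -rp.
  split.
    move=> [r1 [Jr1 /(I_pts k) pr1] rp1]; have [jk rr1] := uniqp _ _ pr1 rp1.
    move=> [[r2 [Nr2 /(I_pts k) pr2] rp2]|[j' /= jk' [r2 [_ /(I_pts j') pr2]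
      rp2]]].
      have [_ rr2] := uniqp _ _ pr2 rp2; apply: Nr2; rewrite rr2 -rr1.
      by case: Jr1 => // dr1; move: nr; rewrite -jk -rr1.
    by have [jj' _] := uniqp _ _ pr2 rp2; rewrite jj' jk eqxx in jk'.
  move=> nK; have [jk|jk] := eqVneq j k; last first.
    by case: nK; right; exists j => //; exists r => //; split=> //;
      apply/(I_pts j).
  exists r; last by rewrite -jk.
  split; last by apply/(I_pts j).
  left; apply: contrapT => ntr; apply: nK; left; exists r; last by rewrite -jk.
  by split=> //; apply/(I_pts j).
have It : I01 t by apply/(I_pts k).
have It' : I01 t' by apply/(I_pts k').
have CK : Cn `&` K1 = Cn.
  apply: cC; last by exists K1.
    exists (curve k t); split=> //; exists t => //; split=> //; left;
      exact/clear_refl.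
  exists (~` K2); first exact: closed_openC.
  by apply/seteqP; split=> p [Cp Kp]; split=> //; apply/(K12 p (CA _ Cp)).
have : K1 (curve k' t') by have [] : (Cn `&` K1) (curve k' t') by rewrite CK.
move=> [r [Jr Ir] rt'].
have pr : pts (k, r) by apply/I_pts.
have [kk rr] : (k', t') = (k, r) by apply: param_unique.
split=> //; rewrite rr; case: Jr => // dr; by case: nt'; rewrite kk rr.
Qed.

Lemma strand_clear s k t k' t' : strands D s -> pts (k, t) -> pts (k', t') ->
  s (curve k t) -> s (curve k' t') -> k = k' /\ clear k t t'.
Proof.
move=> [p Ap <-] pt pt' st st'; apply: connected_clear st st' => //.
  exact: component_connected.
exact: connected_component_sub.
Qed.

(** The image of an interval is connected. *)
Lemma clear_strand s k t t' : strands D s -> pts (k, t) -> pts (k, t') ->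
  s (curve k t) -> clear k t t' -> s (curve k t').
Proof.
move=> [p Ap <-] pt pt' st tt'.
have h := @connected_component_max _ A (curve k @` [set r : R | (t <= r <= t')
    || (t' <= r <= t)]) (curve k t).
rewrite (same_connected_component st).
apply: h; last 1 first.
- by exists t' => //=; rewrite lexx andbT /=; exact: le_total.
- by exists t => //=; rewrite lexx andbT /=; exact: le_total.
- move=> _ [r /= tr <-]; apply/curve_A; last exact: tt'.
  move/ptsE: pt => pt; move/ptsE: pt' => pt'; apply/ptsE.
  by case/orP: tr => tr; lra.
- apply: connected_continuous_connected.
    apply/connected_intervalP => u v /= /orP[]/andP[u1 u2] /orP[]/andP[v1 v2] w
      /andP[uw wv];
    apply/orP; solve [left; lra|right; lra].
  apply: continuous_in_subspaceT => r /set_mem /= tr.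
  apply: (@curve_continuous _ _ D (k, r)).
  move/ptsE: pt => pt; move/ptsE: pt' => pt'; apply/ptsE.
  by case/orP: tr => tr; lra.
Qed.

Lemma strand_point s : strands D s -> exists k t, [/\ pts (k, t),
    s (curve k t) & ~ double_points (k, t)].
Proof.
move=> [p Ap <-]; have [[[k t] pt tp] _] := Ap; exists k, t; split=> //.
  by rewrite -[curve k t]/(point_of (k, t)) tp; exact: connected_component_refl.
by apply/(curve_A pt); move: Ap; rewrite -tp.
Qed.

Lemma double_inside x : double_points x -> 0 < x.2 < 1.
Proof.
move=> dx; have nx := double_interior (tangle_axiomsP D) dx.
case: x dx nx => k t [/ptsE /= /andP[t0 t1] _] nx.
rewrite !lt_neqAle t0 t1 !andbT; apply/andP; split; apply/eqP => e; apply: nx;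
  split=> //=; by [left|right].
Qed.

Lemma into_near s x : double_points x -> strand_into s x -> exists2 e, 0 < e &
  forall t, x.2 - e < t < x.2 -> [/\ pts (x.1, t),
    s (curve x.1 t) & ~ double_points (x.1, t)].
Proof.
case: x => k t dx [/= e1 e10 H1]; have [e2 e20 H2] := double_isolated (k, t).
have /= := double_inside dx => t01.
exists (Num.min (Num.min e1 e2) t); first by rewrite !lt_min e10 e20; lra.
move=> u; rewrite ltrBlDr -ltrBlDl !lt_min => /andP[/andP[/andP[u1 u2] u3] ut].
have tu : `|t - u| = t - u by rewrite ger0_norm// subr_ge0 ltW.
split; first by apply/ptsE; lra.
- by apply: H1; rewrite //= tu.
- by apply: H2; rewrite //= ?tu// lt_eqF.
Qed.

Lemma from_near s x : double_points x -> strand_from s x -> exists2 e, 0 < e &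
  forall t, x.2 < t < x.2 + e -> [/\ pts (x.1, t),
    s (curve x.1 t) & ~ double_points (x.1, t)].
Proof.
case: x => k t dx [/= e1 e10 H1]; have [e2 e20 H2] := double_isolated (k, t).
have /= := double_inside dx => t01.
exists (Num.min (Num.min e1 e2) (1 - t)); first by rewrite !lt_min e10 e20; lra.
move=> u; rewrite -ltrBlDl !lt_min => /andP[tu /andP[/andP[u1 u2] u3]].
have tu' : `|t - u| = u - t by rewrite distrC ger0_norm// subr_ge0 ltW.
split; first by apply/ptsE; lra.
- by apply: H1; rewrite //= tu'.
- by apply: H2; rewrite //= ?tu'// gt_eqF.
Qed.

(** A strand that ends at the passage [x] is traversed before [x] on the same
    component: otherwise [x] would be a double point inside the strand. *)
Lemma into_before s x k t : strands D s -> double_points x -> strand_into s x ->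
  pts (k, t) -> s (curve k t) -> [/\ k = x.1, t < x.2 & forall r,
    t <= r < x.2 -> ~ double_points (k, r)].
Proof.
move=> Ds dx sx pt st; have [e e0 He] := into_near dx sx.
have [|p1 s1 _] := He (x.2 - e / 2); first lra.
have [kx tu] := strand_clear Ds pt p1 st s1.
have tx : t < x.2.
  rewrite ltNge; apply/negP => xt; apply: (tu x.2); first by apply/orP; right;
    lra.
  by rewrite kx -surjective_pairing.
split=> // r rt; have [ru|ur] := leP r (x.2 - e / 2); first by apply: tu; lra.
by rewrite kx; have [|] := He r; first lra.
Qed.

Lemma from_after s x k t : strands D s -> double_points x -> strand_from s x ->
  pts (k, t) -> s (curve k t) -> [/\ k = x.1, x.2 < t & forall r,
    x.2 < r <= t -> ~ double_points (k, r)].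
Proof.
move=> Ds dx sx pt st; have [e e0 He] := from_near dx sx.
have [|p1 s1 _] := He (x.2 + e / 2); first lra.
have [kx tu] := strand_clear Ds pt p1 st s1.
have tx : x.2 < t.
  rewrite ltNge; apply/negP => xt; apply: (tu x.2); first by apply/orP; left;
    lra.
  by rewrite kx -surjective_pairing.
split=> // r rt; have [ru|ur] := leP (x.2 + e / 2) r; first by apply: tu;
  apply/orP; right; lra.
by rewrite kx; have [|] := He r; first lra.
Qed.

(** Of two distinct ends on one component, the earlier one would separate the
    strand. *)
Lemma into_unique s x y : strands D s -> double_points x -> double_points y ->
  strand_into s x -> strand_into s y -> x = y.
Proof.
move=> Ds dx dy sx sy.
have [e e0 He] := into_near dx sx; have [e' e'0 He'] := into_near dy sy.
have [|p1 s1 _] := He (x.2 - e / 2); first lra.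
have [|p2 s2 _] := He' (y.2 - e' / 2); first lra.
have [xy l1 c1] := into_before Ds dy sy p1 s1.
have [_ l2 c2] := into_before Ds dx sx p2 s2.
have [lt|lt|] := ltgtP x.2 y.2.
- by case: (c1 x.2); [lra|rewrite -surjective_pairing].
- by case: (c2 y.2); [lra|rewrite -surjective_pairing].
- by case: x y xy {dx dy sx sy He He' l1 c1 l2 c2 p1 p2 s1 s2} =>
    [k t] [k' t'] /= -> ->.
Qed.

Lemma from_unique s x y : strands D s -> double_points x -> double_points y ->
  strand_from s x -> strand_from s y -> x = y.
Proof.
move=> Ds dx dy sx sy.
have [e e0 He] := from_near dx sx; have [e' e'0 He'] := from_near dy sy.
have [|p1 s1 _] := He (x.2 + e / 2); first lra.
have [|p2 s2 _] := He' (y.2 + e' / 2); first lra.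
have [xy l1 c1] := from_after Ds dy sy p1 s1.
have [_ l2 c2] := from_after Ds dx sx p2 s2.
have [lt|lt|] := ltgtP x.2 y.2.
- by case: (c2 y.2); [lra|rewrite -surjective_pairing].
- by case: (c1 x.2); [lra|rewrite -surjective_pairing].
- by case: x y xy {dx dy sx sy He He' l1 c1 l2 c2 p1 p2 s1 s2} =>
    [k t] [k' t'] /= -> ->.
Qed.
End Strands.

(** * Strands crossing the boundary of a region *)

(** [c] is the supremum of the parameters where the closed condition [P] fails. *)
Lemma last_entry (R : realType) (P : R -> Prop) (a b : R) : a <= b -> ~ P a ->
    P b ->
  (forall r, a <= r <= b -> ~ P r -> exists2 e : R, 0 < e & forall u,
    `|r - u| < e -> ~ P u) ->
  exists c, [/\ a < c <= b, forall r, c <= r <= b -> P r &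
    forall e : R, 0 < e -> exists2 r : R, c - e < r < c & ~ P r].
Proof.
move=> ab nPa Pb op.
pose B : set R := [set r : R | a <= r <= b /\ ~ P r].
have Ba : B a by rewrite /B /= lexx ab.
have hB : has_sup B by split; [exists a|exists b => r [/andP[]]].
have ub : forall r, B r -> r <= sup B by move=> r; exact: sup_upper_bound.
have ac := ub _ Ba.
have cb : sup B <= b by apply: ge_sup; [exists a|move=> r [/andP[]]].
have Pc : P (sup B).
  apply: contrapT => nPc; have [|e e0 He] := op (sup B) _ nPc;
    first by rewrite ac cb.
  have cb' : sup B < b by rewrite lt_neqAle cb andbT; apply/eqP => cE;
      apply: nPc; rewrite cE.
  pose u := Num.min (sup B + e / 2) b.
  have cu : sup B < u by rewrite lt_min cb' andbT; lra.
  have : B u.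
    split; first by rewrite ge_min lexx orbT andbT (le_trans ac (ltW cu)).
    apply: He; rewrite distrC ger0_norm ?subr_ge0 ?(ltW cu)//.
    have : u <= sup B + e / 2 by rewrite ge_min lexx.
    lra.
  by move=> /ub; rewrite leNgt cu.
exists (sup B); split.
- rewrite cb andbT lt_neqAle ac andbT; apply/eqP => aE; apply: nPa;
    by rewrite aE.
- move=> r /andP[cr rb]; apply: contrapT => nPr.
  have /ub rc : B r by split=> //; rewrite (le_trans ac cr) rb.
  have rE : r = sup B by apply/eqP; rewrite eq_le rc cr.
  by apply: nPr; rewrite rE.
- move=> e e0; have [r [rab nPr] er] := sup_adherent e0 hB.
  exists r => //; rewrite er /= lt_neqAle ub// andbT.
  by apply/eqP => rE; apply: nPr; rewrite rE.
Qed.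

(** [last_entry] after reversal of the parameter. *)
Lemma first_exit (R : realType) (P : R -> Prop) (a b : R) : a <= b -> P a ->
    ~ P b ->
  (forall r, a <= r <= b -> ~ P r -> exists2 e : R, 0 < e & forall u,
    `|r - u| < e -> ~ P u) ->
  exists c, [/\ a <= c < b, forall r, a <= r <= c -> P r &
    forall e : R, 0 < e -> exists2 r : R, c < r < c + e & ~ P r].
Proof.
move=> ab Pa nPb op.
have [||||c [cab cP cn]] := @last_entry R (fun r => P (- r)) (- b) (- a).
- by rewrite lerN2.
- by rewrite opprK.
- by rewrite opprK.
- move=> r rab nPr; have [|e e0 He] := op (- r) _ nPr; first lra.
  by exists e => // u ru; apply: He; rewrite opprK addrC distrC.
exists (- c); split; first lra.
- by move=> r rac; rewrite -[r]opprK; apply: cP; lra.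
- move=> e e0; have [r rc nPr] := cn e e0; exists (- r) => //; lra.
Qed.

Section Region.
Variables (R : realType) (Sigma : set (plane R)) (D : tangle_diagram Sigma).
Hypothesis no_closed : forall k : component D, ~~ is_circle k.
Variable U : set (plane R).
Hypothesis hU : planar_surface U.
Hypothesis U_transverse : forall x : component D * R, pts x ->
    bdry U (point_of x) ->
     transverse_to_bdry U (point_of x) (velocity x).
Hypothesis U_avoid : forall p, crossing_points D p -> ~ bdry U p.
Hypothesis U_strands : forall s p q, strands D s -> s p -> bdry U p ->
     s q -> bdry U q -> p = q.
Local Notation param := (component D * R)%type.
Implicit Types (x y : param) (k : component D) (s t : set (plane R)).
Local Notation A := (diagram_set D `\` crossing_points D).
Local Notation ptsE := (ptsE no_closed).

Lemma U_closed : closed U.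
Proof. by apply: compact_closed; [exact: norm_hausdorff|case: hU]. Qed.

Lemma curve_near k (t : R) (W : set (plane R)) : pts (k, t) ->
    nbhs (curve k t) W ->
  exists2 e : R, 0 < e & forall u, `|t - u| < e -> W (curve k u).
Proof.
move=> pt Wp; have := @curve_continuous _ _ D (k, t) pt W Wp.
by move=> [/= e e0 He]; exists e => // u tu; apply: He.
Qed.

Lemma curve_entry k (a b : R) : pts (k, a) -> pts (k, b) -> a <= b ->
  ~ U (curve k a) -> U (curve k b) ->
  exists c, [/\ a < c <= b, bdry U (curve k c) & forall r, c <= r <= b ->
    U (curve k r)].
Proof.
move=> pa pb ab nUa Ub.
have pab (r : R) : a <= r <= b -> pts (k, r).
  by move: pa pb => /ptsE pa /ptsE pb rab; apply/ptsE; lra.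
have [r /pab pr nUr|c [cab Uc nc]] := @last_entry R (fun r =>
    U (curve k r)) a b ab nUa Ub.
  by apply: (@curve_near k r (~` U) pr); apply: open_nbhs_nbhs; split=> //;
    exact: closed_openC U_closed.
exists c; split=> //; split; first by apply: Uc; rewrite lexx; case/andP: cab.
move=> iU; have [|e e0 He] := curve_near (pab c _) iU.
  by case/andP: cab => /ltW -> ->.
have [r rc] := nc e e0; apply; apply: He; rewrite ger0_norm; lra.
Qed.

Lemma curve_exit k (a b : R) : pts (k, a) -> pts (k, b) -> a <= b ->
  U (curve k a) -> ~ U (curve k b) ->
  exists c, [/\ a <= c < b, bdry U (curve k c) & forall r, a <= r <= c ->
    U (curve k r)].
Proof.
move=> pa pb ab Ua nUb.
have pab (r : R) : a <= r <= b -> pts (k, r).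
  by move: pa pb => /ptsE pa /ptsE pb rab; apply/ptsE; lra.
have [r /pab pr nUr|c [cab Uc nc]] := @first_exit R (fun r =>
    U (curve k r)) a b ab Ua nUb.
  by apply: (@curve_near k r (~` U) pr); apply: open_nbhs_nbhs; split=> //;
    exact: closed_openC U_closed.
exists c; split=> //; split; first by apply: Uc; rewrite lexx andbT;
  case/andP: cab.
move=> iU; have [|e e0 He] := curve_near (pab c _) iU.
  by case/andP: cab => -> /ltW ->.
have [r rc] := nc e e0; apply; apply: He; rewrite ler0_norm; lra.
Qed.

Lemma crossing_interior x : double_points x -> U (point_of x) ->
    U° (point_of x).
Proof.
move=> dx Ux; apply: contrapT => nU; apply: (@U_avoid (point_of x)); last by [].
by exists x.
Qed.

Lemma bdry_single x : pts x -> bdry U (point_of x) -> ~ double_points x.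
Proof. by move=> px bx dx; apply: (U_avoid _ bx); exists x. Qed.

Lemma bdry_unique s x y : strands D s -> pts x -> pts y -> s (point_of x) ->
    s (point_of y) ->
  bdry U (point_of x) -> bdry U (point_of y) -> x = y.
Proof.
move=> Ds px py sx sy bx yb; apply: param_unique => //.
  exact: U_strands Ds sx bx sy yb.
exact: bdry_single.
Qed.

Lemma derive_curve k (c : R) (f : plane R -> R) : pts (k, c) ->
  differentiable f (curve k c) ->
  is_derive c 1 (f \o curve k) ('D_(velocity (k, c)) f (curve k c)).
Proof.
move=> pc df.
have [/derivable1_diffP de _] := emb_C1 (tangle_axiomsP D) pc.
have dc : differentiable (curve k) c.
  apply: (@differentiable_comp _ _ _ _ (emb k) fst) => //.
  by apply: linear_differentiable => p; exact: cvg_fst.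
have dfc : differentiable (f \o curve k) c by exact: differentiable_comp.
apply: DeriveDef; first exact/derivable1_diffP.
rewrite deriveE// diff_comp//= deriveE//; congr ('d f _ _).
by rewrite /velocity derive1E deriveE.
Qed.

(** The difference quotients of [g] at its zero [c] are negative near [c]. *)
Lemma sign_change (g : R -> R) (c d : R) : is_derive c 1 g d -> d < 0 ->
    g c = 0 ->
  exists2 e : R, 0 < e & forall u, `|c - u| < e -> (c < u -> g u < 0) /\
    (u < c -> 0 < g u).
Proof.
move=> [dg dE] d0 gc.
have H : h^-1 *: (g (h *: 1 + c) - g c) @[h --> (0 : R)^'] --> d.
  by rewrite -dE; exact: dg.
have [/= e e0 He] := cvgr_lt d H 0 d0.
exists e => // u cu.
have {}He : u != c -> (u - c)^-1 * g u < 0.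
  move=> uc; have := He (u - c); rewrite /= sub0r normrN distrC => /(_ cu).
  rewrite subr_eq0 => /(_ uc); rewrite gc subr0.
  by rewrite [_ *: 1]mulr1 subrK.
split=> ucl.
- by have := He (negbT (gt_eqF ucl)); rewrite pmulr_rlt0// invr_gt0 subr_gt0.
- by have := He (negbT (lt_eqF ucl)); rewrite nmulr_rlt0// invr_lt0 subr_lt0.
Qed.

(** The chain rule gives the sign of the derivative of [f] along the curve,
    and [U] is the locus where [f] is nonpositive. *)
Lemma crossing_bdry x f : pts x -> defining_function U (point_of x) f ->
  'D_(velocity x) f (point_of x) < 0 ->
  exists2 e : R, 0 < e & forall u, `|x.2 - u| < e ->
    (x.2 < u -> U (curve x.1 u)) /\ (u < x.2 -> ~ U (curve x.1 u)).
Proof.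
case: x => k c px [f0 fd _ fU] fv.
have df : differentiable f (curve k c) by have [] := nbhs_singleton fd.
have [e e0 He] := sign_change (derive_curve px df) fv f0.
have [e' e'0 He'] := curve_near px fU.
exists (Num.min e e'); first by rewrite lt_min e0.
move=> u; rewrite lt_min => /andP[/He[H1 H2] /He' /= HU]; split=> cu.
- by apply/HU/ltW/H1.
- by move=> /HU; rewrite leNgt => /negP; apply; exact: H2.
Qed.

Lemma crossing_bdry_out x f : pts x -> defining_function U (point_of x) f ->
  0 < 'D_(velocity x) f (point_of x) ->
  exists2 e : R, 0 < e & forall u, `|x.2 - u| < e ->
    (x.2 < u -> ~ U (curve x.1 u)) /\ (u < x.2 -> U (curve x.1 u)).
Proof.
case: x => k c px [f0 fd _ fU] fv.
have df : differentiable f (curve k c) by have [] := nbhs_singleton fd.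
have fN : is_derive c 1 (- (f \o curve k)) (- 'D_(velocity (k,
    c)) f (curve k c)).
  exact/is_deriveN/derive_curve.
have [||e e0 He] := sign_change fN; first by rewrite oppr_lt0.
  by rewrite fctE /= -[f _]/(f (point_of (k, c))) f0 oppr0.
have [e' e'0 He'] := curve_near px fU.
exists (Num.min e e'); first by rewrite lt_min e0.
move=> u; rewrite lt_min => /andP[/He[H1 H2] /He' /= HU]; split=> cu.
- move=> /HU; rewrite leNgt => /negP; apply.
  by have := H1 cu; rewrite fctE oppr_lt0.
- by apply/HU/ltW; have := H2 cu; rewrite fctE oppr_gt0.
Qed.

Lemma points_intoP x : pts x -> bdry U (point_of x) ->
    points_into U (point_of x) (velocity x) ->
  exists2 e : R, 0 < e & forall u, `|x.2 - u| < e ->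
    (x.2 < u -> U (curve x.1 u)) /\ (u < x.2 -> ~ U (curve x.1 u)).
Proof. by move=> px bx [f ff fv]; exact: crossing_bdry ff fv. Qed.

(** By transversality a defining function has a nonzero derivative along the
    curve, which is then positive. *)
Lemma not_points_intoP x : pts x -> bdry U (point_of x) ->
    ~ points_into U (point_of x) (velocity x) ->
  exists2 e : R, 0 < e & forall u, `|x.2 - u| < e ->
    (x.2 < u -> ~ U (curve x.1 u)) /\ (u < x.2 -> U (curve x.1 u)).
Proof.
move=> px bx nx; have [f ff fv] := U_transverse px bx.
apply: (crossing_bdry_out px ff); rewrite lt_neqAle eq_sym fv /= leNgt.
by apply/negP => fv0; apply: nx; exists f.
Qed.

Lemma strand_param s p : strands D s -> s p -> exists2 x : param,
    pts x & point_of x = p.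
Proof.
move=> [q Aq <-] sp; have [[x px xp] _] := connected_component_sub sp.
by exists x.
Qed.

Lemma into_meets s x (W : set (plane R)) : strand_into s x -> double_points x ->
  nbhs (point_of x) W -> s `&` W !=set0.
Proof.
case: x => k c sx dx Wx; have [e e0 He] := into_near no_closed dx sx.
have px : pts (k, c) by case: dx.
have [e' e'0 He'] := curve_near px Wx.
pose u := c - Num.min e e' / 2.
have m0 : 0 < Num.min e e' by rewrite lt_min e0.
have m1 : Num.min e e' <= e by rewrite ge_min lexx.
have m2 : Num.min e e' <= e' by rewrite ge_min lexx orbT.
have [|_ su _] := He u; first by rewrite /= /u; lra.
exists (curve k u); split=> //; apply: He'.
by rewrite /u opprB addrC subrK ger0_norm; lra.
Qed.

Lemma from_meets s x (W : set (plane R)) : strand_from s x -> double_points x ->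
  nbhs (point_of x) W -> s `&` W !=set0.
Proof.
case: x => k c sx dx Wx; have [e e0 He] := from_near no_closed dx sx.
have px : pts (k, c) by case: dx.
have [e' e'0 He'] := curve_near px Wx.
pose u := c + Num.min e e' / 2.
have m0 : 0 < Num.min e e' by rewrite lt_min e0.
have m1 : Num.min e e' <= e by rewrite ge_min lexx.
have m2 : Num.min e e' <= e' by rewrite ge_min lexx orbT.
have [|_ su _] := He u; first by rewrite /= /u; lra.
exists (curve k u); split=> //; apply: He'.
by rewrite /u opprD addrA subrr sub0r normrN ger0_norm; lra.
Qed.

Lemma nbhs_in x : double_points x -> U (point_of x) -> nbhs (point_of x) U.
Proof. by move=> dx /(crossing_interior dx). Qed.

Lemma nbhs_out x : ~ U (point_of x) -> nbhs (point_of x) (~` U).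
Proof. by move=> nU; apply: open_nbhs_nbhs; split=> //;
  exact: closed_openC U_closed. Qed.

(** The strand visits the complement of [U] and ends in the interior of [U]: after
    its last entry it stays in [U] from then on, which excludes the direction
    pointing out of [U]. *)
Lemma into_incoming s x : strands_in D (~` U) s -> double_points x ->
  strand_into s x -> U (point_of x) -> incoming D U s.
Proof.
case: x => k b [Ds [p [sp nUp]]] dx sx Ux; split; first 1 last.
- by split=> //; exists p.
- have [[k' a] pa ap] := strand_param Ds sp.
  have sa : s (curve k' a) by move: sp; rewrite -ap.
  have nUa : ~ U (curve k' a) by move: nUp; rewrite -ap.
  have [/= kk ab cl] := into_before no_closed Ds dx sx pa sa.
  move: kk pa ap sa nUa cl => -> pa ap sa nUa cl.
  have px : pts (k, b) by case: dx.
  have [c [/andP[ac cb] bc cU]] := curve_entry pa px (ltW ab) nUa Ux.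
  have {}cb : c < b.
    rewrite lt_neqAle cb andbT; apply/eqP => cE; move: bc; rewrite cE => bb.
    by apply: (U_avoid _ bb); exists (k, b).
  have pc : pts (k, c) by move: pa px => /ptsE pa /ptsE px; apply/ptsE; lra.
  exists (k, c); split=> //.
    apply: clear_strand Ds pa pc sa _ => // r rac; apply: cl.
    by case/orP: rac => rac; lra.
  apply: contrapT => /(not_points_intoP pc bc)[e e0 /= He].
  pose u := c + Num.min e (b - c) / 2.
  have m0 : 0 < Num.min e (b - c) by rewrite lt_min e0 subr_gt0.
  have m1 : Num.min e (b - c) <= e by rewrite ge_min lexx.
  have m2 : Num.min e (b - c) <= b - c by rewrite ge_min lexx orbT.
  have [|+ _] := He u; first by rewrite /u opprD addrA subrr sub0r normrN
      ger0_norm; lra.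
  by move=> h; apply: h; [rewrite /u; lra|apply: cU; rewrite /u; lra].
- by split=> //; exact: into_meets sx dx (nbhs_in dx Ux).
Qed.

(** Just after the boundary point of an incoming strand the curve is in [U]; if
    it ended outside, it would meet the boundary a second time. *)
Lemma incoming_into s x : incoming D U s -> double_points x ->
    strand_into s x -> U (point_of x).
Proof.
case: x => k b [[Ds _] _ [[k' c] [pc sc bc ic]]] dx sx; apply: contrapT => nUx.
have [/= kk cb cl] := into_before no_closed Ds dx sx pc sc.
move: kk pc sc bc ic cl => -> pc sc bc ic cl.
have px : pts (k, b) by case: dx.
have [e e0 /= He] := points_intoP pc bc ic.
pose u := c + Num.min e (b - c) / 2.
have m0 : 0 < Num.min e (b - c) by rewrite lt_min e0 subr_gt0.
have m1 : Num.min e (b - c) <= e by rewrite ge_min lexx.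
have m2 : Num.min e (b - c) <= b - c by rewrite ge_min lexx orbT.
have pu : pts (k, u) by move: pc px => /ptsE pc /ptsE px; apply/ptsE;
    rewrite /u; lra.
have Uu : U (curve k u).
  have [|+ _] := He u; first by rewrite /u opprD addrA subrr sub0r normrN
      ger0_norm; lra.
  by apply; rewrite /u; lra.
have [|c' [c'1 bc' _]] := curve_exit pu px _ Uu nUx; first by rewrite /u; lra.
have pc' : pts (k, c') by move: pu px => /ptsE pu /ptsE px; apply/ptsE; lra.
have cc' : c < c' by move: c'1; rewrite /u; lra.
have sc' : s (curve k c').
  apply: clear_strand Ds pc pc' sc _ => // r rac; apply: cl.
  by case/orP: rac => rac; lra.
have [cE] := bdry_unique Ds pc pc' sc sc' bc bc'.
by rewrite cE ltxx in cc'.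
Qed.

(** The first exit of a strand that starts in [U]. *)
Lemma from_outgoing s x : strands_in D (~` U) s -> double_points x ->
  strand_from s x -> U (point_of x) -> outgoing D U s.
Proof.
case: x => k b [Ds [p [sp nUp]]] dx sx Ux; split; first 1 last.
- by split=> //; exists p.
- have [[k' a] pa ap] := strand_param Ds sp.
  have sa : s (curve k' a) by move: sp; rewrite -ap.
  have nUa : ~ U (curve k' a) by move: nUp; rewrite -ap.
  have [/= kk ab cl] := from_after no_closed Ds dx sx pa sa.
  move: kk pa ap sa nUa cl => -> pa ap sa nUa cl.
  have px : pts (k, b) by case: dx.
  have [c [/andP[bc' ca] bc cU]] := curve_exit px pa (ltW ab) Ux nUa.
  have {}cb : b < c.
    rewrite lt_neqAle bc' andbT; apply/eqP => cE; move: bc; rewrite -cE => bb.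
    by apply: (U_avoid _ bb); exists (k, b).
  have pc : pts (k, c) by move: pa px => /ptsE pa /ptsE px; apply/ptsE; lra.
  exists (k, c); split=> //.
    apply: clear_strand Ds pa pc sa _ => // r rac; apply: cl.
    by case/orP: rac => rac; lra.
  move=> /(points_intoP pc bc)[e e0 /= He].
  pose u := c - Num.min e (c - b) / 2.
  have m0 : 0 < Num.min e (c - b) by rewrite lt_min e0 subr_gt0.
  have m1 : Num.min e (c - b) <= e by rewrite ge_min lexx.
  have m2 : Num.min e (c - b) <= c - b by rewrite ge_min lexx orbT.
  have [|_ +] := He u; first by rewrite /u opprB addrC subrK ger0_norm; lra.
  by move=> h; apply: h; [rewrite /u; lra|apply: cU; rewrite /u; lra].
- by split=> //; exact: from_meets sx dx (nbhs_in dx Ux).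
Qed.

(** A strand meets the boundary at one parameter only, with one direction. *)
Lemma incoming_not_outgoing s : incoming D U s -> ~ outgoing D U s.
Proof.
move=> [[Ds _] _ [x [px sx bx ix]]] [_ _ [y [py sy yb oy]]].
by apply: oy; rewrite -(bdry_unique Ds px py sx sy bx yb).
Qed.

(** A strand is traversed along an interval, so between a point in [U] and one outside
    there is a boundary point. *)
Lemma shared_strand s : strands_in D U s -> strands_in D (~` U) s ->
  incoming D U s \/ outgoing D U s.
Proof.
move=> sU sV; have [Ds [p [sp Up]]] := sU; have [_ [q [sq nUq]]] := sV.
have [[k a] pa ap] := strand_param Ds sp; have [[k' b] pb bq] :=
    strand_param Ds sq.
move: sp Up sq nUq; rewrite -ap -bq /point_of /= => sa Ua sb nUb {p q ap bq}.
have [kk cl] := strand_clear no_closed Ds pa pb sa sb.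
move: kk pb sb nUb => <- pb sb nUb {k'}.
suff [c [pc sc bc]] : exists c, [/\ pts (k, c),
    s (curve k c) & bdry U (curve k c)].
  have [i|i] := EM (points_into U (curve k c) (velocity (k, c))).
    by left; split=> //; exists (k, c).
  by right; split=> //; exists (k, c).
have [ab|/ltW ba] := leP a b.
- have [c [cab bc _]] := curve_exit pa pb ab Ua nUb.
  have pc : pts (k, c) by move: pa pb => /ptsE pa /ptsE pb; apply/ptsE; lra.
  exists c; split=> //; apply: clear_strand Ds pa pc sa _ => // r rac;
    apply: cl.
  by apply/orP; left; case/orP: rac; lra.
- have [c [cab bc _]] := curve_entry pb pa ba nUb Ua.
  have pc : pts (k, c) by move: pa pb => /ptsE pa /ptsE pb; apply/ptsE; lra.
  exists c; split=> //; apply: clear_strand Ds pa pc sa _ => // r rac;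
    apply: cl.
  by apply/orP; right; case/orP: rac; lra.
Qed.
End Region.

(** * Crossings, contraction and the theorem *)

Section Crossings.
Variables (R : realType) (Sigma : set (plane R)) (D : tangle_diagram Sigma).
Hypothesis no_closed : forall k : component D, ~~ is_circle k.
Local Notation param := (component D * R)%type.
Implicit Types (x y w z : param) (s t : set (plane R)) (W : set (plane R)).

Lemma crossing_double x y : crossing x y -> double_points x /\ double_points y.
Proof.
move=> [px py xy lt]; have ne : y <> x by move=> e; rewrite e ltxx in lt.
split; split=> //; first by exists y.
by exists x; split=> // e; apply: ne.
Qed.

(** There are no triple points. *)
Lemma same_over x y y' : crossing x y -> crossing x y' -> y = y'.
Proof.
move=> [px py xy lt] [_ py' xy' lt'].
have [e|e|//] := no_triple (tangle_axiomsP D) py px py' (esym xy) xy'.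
  by rewrite e ltxx in lt.
by rewrite e ltxx in lt'.
Qed.

Lemma over_not_under x y z : crossing x y -> ~ crossing z x.
Proof.
move=> [px py xy lt] [pz _ zx lt'].
have [e|e|e] := no_triple (tangle_axiomsP D) pz px py zx xy.
- by rewrite e ltxx in lt'.
- by rewrite e ltxx in lt.
- by rewrite e in lt'; have := lt_trans lt lt'; rewrite ltxx.
Qed.

Lemma over_neq_under x y : crossing x y -> x <> y.
Proof. by move=> [_ _ _ lt] e; rewrite e ltxx in lt. Qed.

Lemma crossing_value_ends W s t a : crossing_value D W s t a ->
    exists w z : param,
  [/\ [/\ double_points w, double_points z & point_of w = point_of z],
    W (point_of w),
      strand_into s w & strand_from t z].
Proof.
move=> [x [y [c Wx H]]]; have [dx dy] := crossing_double c; have [_ _ xy _] :=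
  c.
by case: H => [[sx tz _]|[sx tz _]|[sx tz _]]; [exists x, x|exists x,
  y|exists y, y];
  split=> //; rewrite -xy.
Qed.

(** The strand [s] ends at one passage, which determines the crossing and whether
    [s] is over or under there; [t] starts at one passage, which decides between
    [T^sigma] and [1 - T^sigma]. *)
Lemma crossing_value_unique W W' s t a a' : strands D s -> strands D t ->
  crossing_value D W s t a -> crossing_value D W' s t a' -> a = a'.
Proof.
move=> Ds Dt [x [y [c _ H]]] [x' [y' [c' _ H']]].
have [dx dy] := crossing_double c; have [dx' dy'] := crossing_double c'.
case: H => [[i1 o1 ea]|[i1 o1 ea]|[i1 o1 ea]];
  case: H' => [[i2 o2 ea']|[i2 o2 ea']|[i2 o2 ea']].
- have xx := into_unique no_closed Ds dx dx' i1 i2; rewrite -xx in c' ea'.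
  rewrite -(same_over c c') in ea'; exact (etrans ea (esym ea')).
- have xx := into_unique no_closed Ds dx dx' i1 i2; rewrite -xx in c'.
  have xy := from_unique no_closed Dt dx dy' o1 o2.
  by case: (over_neq_under c'); rewrite xy.
- have xy := into_unique no_closed Ds dx dy' i1 i2; rewrite -xy in c'.
  by case: (over_not_under c c').
- have xx := into_unique no_closed Ds dx dx' i1 i2; rewrite -xx in c'.
  have yx := from_unique no_closed Dt dy dx' o1 o2.
  by case: (over_neq_under c); rewrite yx xx.
- have xx := into_unique no_closed Ds dx dx' i1 i2; rewrite -xx in c' ea'.
  rewrite -(same_over c c') in ea'; exact (etrans ea (esym ea')).
- have xy := into_unique no_closed Ds dx dy' i1 i2; rewrite -xy in c'.
  by case: (over_not_under c c').
- have yx := into_unique no_closed Ds dy dx' i1 i2; rewrite -yx in c'.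
  by case: (over_not_under c' c).
- have yx := into_unique no_closed Ds dy dx' i1 i2; rewrite -yx in c'.
  by case: (over_not_under c' c).
- exact (etrans ea (esym ea')).
Qed.

Lemma crossing_transE W s t a : strands D s -> strands D t ->
  crossing_value D W s t a -> crossing_trans D W s t = a.
Proof.
move=> Ds Dt c; apply: xget_unique => // a' c'.
exact: crossing_value_unique Ds Dt c' c.
Qed.

Lemma crossing_trans_none W s t :
  ~ (exists a, crossing_value D W s t a) -> crossing_trans D W s t = 0.
Proof. by move=> H; apply: xgetPN => a c; apply: H; exists a. Qed.

Lemma crossing_trans_neq0 W s t : crossing_trans D W s t != 0 ->
  exists a, crossing_value D W s t a.
Proof.
by move=> nz; apply: contrapT => /crossing_trans_none e; rewrite e eqxx in nz.
Qed.

Lemma pts_in_Sigma x : pts x -> Sigma (point_of x).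
Proof.
move=> px; have [ex|nx] := EM (endpoint x).
  by have [[]] := emb_bdry (tangle_axiomsP D) px ex.
by have [/interior_subset] := emb_int (tangle_axiomsP D) px nx.
Qed.

Lemma strands_in_Sigma s : strands_in D Sigma s <-> strands D s.
Proof.
split=> [[]//|Ds]; split=> //.
have [k [r [pr sr _]]] := strand_point Ds.
by exists (curve k r); split=> //; exact: (pts_in_Sigma pr).
Qed.

(** A pair of strands is joined by at most one crossing, which is either in [U] or
    outside. *)
Lemma crossing_trans_split U s t : strands D s -> strands D t ->
  crossing_trans D Sigma s t = crossing_trans D U s t + crossing_trans D (~` U)
    s t.
Proof.
move=> Ds Dt; have [[a c]|n] := EM (exists a, crossing_value D Sigma s t a);
  last first.
  have sub W : crossing_trans D W s t = 0.
    apply: crossing_trans_none => -[a [x [y [c _ H]]]]; apply: n; exists a, x,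
      y; split=> //.
    by apply: pts_in_Sigma; case: c.
  by rewrite !sub addr0.
rewrite (crossing_transE Ds Dt c).
have [x [y [cr _ H]]] := c.
have excl : ~ ((exists a, crossing_value D U s t a) /\ (exists a,
    crossing_value D (~` U) s t a)).
  move=> [[a1 /crossing_value_ends[w [_ [[dw _ _] Uw sw _]]]]].
  move=> [a2 /crossing_value_ends[w' [_ [[dw' _ _] Uw' sw' _]]]].
  by apply: Uw'; rewrite -(into_unique no_closed Ds dw dw' sw sw').
have [Ux|nUx] := EM (U (point_of x)).
  have cU : crossing_value D U s t a by exists x, y.
  rewrite (crossing_transE Ds Dt cU) crossing_trans_none ?addr0// => cn.
  by apply: excl; split=> //; exists a.
have cU : crossing_value D (~` U) s t a by exists x, y.
rewrite (crossing_transE Ds Dt cU) crossing_trans_none ?add0r// => cn.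
by apply: excl; split=> //; exists a.
Qed.

(** Some parameter of a point of [s]; any choice increases along transitions
    that stay on a component. *)
Definition strand_pos s : R :=
  xget 0 [set r : R | exists k : component D, pts (k, r) /\ s (curve k r)].

Lemma strand_posP s : strands D s ->
  exists k : component D, pts (k, strand_pos s) /\ s (curve k (strand_pos s)).
Proof.
move=> Ds; have [k [r [pr sr _]]] := strand_point Ds.
by apply: (@xgetPex _ 0 [set r : R | exists k : component D, pts (k, r) /\
  s (curve k r)]); exists r, k.
Qed.

Lemma strand_pos_lt s t x : strands D s -> strands D t -> double_points x ->
  strand_into s x -> strand_from t x -> strand_pos s < strand_pos t.
Proof.
move=> Ds Dt dx sx tx.
have [k [ps ss]] := strand_posP Ds; have [k' [pt tt]] := strand_posP Dt.
have [_ l1 _] := into_before no_closed Ds dx sx ps ss.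
have [_ l2 _] := from_after no_closed Dt dx tx pt tt.
exact: lt_trans l1 l2.
Qed.

(** At [T = 1] the jump from over to under has weight [1 - 1], so only transitions
    along a component remain. *)
Lemma crossing_trans_value1 W s t : strands D s -> strands D t ->
  exists2 v : R[i], ZT_value (crossing_trans D W s t) 1 v &
    v != 0 -> strand_pos s < strand_pos t.
Proof.
move=> Ds Dt; have [[a c]|/crossing_trans_none ->] := EM (exists a,
  crossing_value D W s t a);
  last by exists 0; [exact: ZT_value0|rewrite eqxx].
rewrite (crossing_transE Ds Dt c).
have [x [y [cr _ H]]] := c; have [dx dy] := crossing_double cr.
case: H => -[i o ->].
- by exists 1; [exact: ZT_value_Tpow|move=> _; exact: strand_pos_lt i o].
- exists (1 - 1); last by rewrite subrr eqxx.
  by apply: ZT_valueD; [exact: ZT_value1|apply/ZT_valueN/ZT_value_Tpow].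
- by exists 1; [exact: ZT_value1|move=> _; exact: strand_pos_lt i o].
Qed.

Lemma subchain_regular W s t : states (subchain D W) s ->
    states (subchain D W) t ->
  regular_at (trans (subchain D W) s t) (1 : R[i]).
Proof.
by move=> [Ds _] [Dt _]; have [v v1 _] := crossing_trans_value1 W Ds Dt;
  exists v.
Qed.

Lemma subchain_increasing W s t : states (subchain D W) s ->
    states (subchain D W) t ->
  ZT_eval (trans (subchain D W) s t) (1 : R[i]) != 0 ->
    strand_pos s < strand_pos t.
Proof.
move=> [Ds _] [Dt _]; have [v v1 vlt] := crossing_trans_value1 W Ds Dt.
by rewrite (ZT_value_eval v1).
Qed.
End Crossings.

Section Contraction.
Variables (R : realType) (Sigma : set (plane R)) (D : tangle_diagram Sigma).
Hypothesis no_closed : forall k : component D, ~~ is_circle k.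
Variable U : set (plane R).
Hypothesis hU : planar_surface U.
Hypothesis U_transverse : forall x : component D * R, pts x ->
    bdry U (point_of x) ->
     transverse_to_bdry U (point_of x) (velocity x).
Hypothesis U_avoid : forall p, crossing_points D p -> ~ bdry U p.
Hypothesis U_strands : forall s p q, strands D s -> s p -> bdry U p ->
     s q -> bdry U q -> p = q.
Implicit Types (s t u : set (plane R)).

Local Notation AU := (crossing_trans D U).
Local Notation AV := (crossing_trans D (~` U)).
Local Notation SU := (strands_in D U).
Local Notation SV := (strands_in D (~` U)).
Local Notation II := (incoming D U).
Local Notation OO := (outgoing D U).

Lemma AU_states s t : strands D s -> strands D t -> AU s t != 0 -> SU s /\ SU t.
Proof.
move=> Ds Dt /crossing_trans_neq0[a /crossing_value_ends[w [z [[dw dz wz] Uw sw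
  tz]]]].
have Uz : U (point_of z) by rewrite -wz.
by split; split=> //; [exact: into_meets sw dw (nbhs_in U_avoid dw Uw)|
  exact: from_meets tz dz (nbhs_in U_avoid dz Uz)].
Qed.

Lemma AU_incoming s t : SV s -> AU s t != 0 -> II s.
Proof.
move=> Vs /crossing_trans_neq0[a /crossing_value_ends[w [z [[dw dz wz] Uw sw
  tz]]]].
exact: into_incoming Vs dw sw Uw.
Qed.

Lemma AU_outgoing s t : SV t -> AU s t != 0 -> OO t.
Proof.
move=> Vt /crossing_trans_neq0[a /crossing_value_ends[w [z [[dw dz wz] Uw sw
  tz]]]].
by apply: from_outgoing Vt dz tz _ => //; rewrite -wz.
Qed.

Lemma AV_states s t : strands D s -> strands D t -> AV s t != 0 -> SV s /\ SV t.
Proof.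
move=> Ds Dt /crossing_trans_neq0[a /crossing_value_ends[w [z [[dw dz wz] Uw sw
  tz]]]].
have Uz : ~ U (point_of z) by rewrite -wz.
by split; split=> //; [exact: into_meets sw dw (nbhs_out hU Uw)|
  exact: from_meets tz dz (nbhs_out hU Uz)].
Qed.

Lemma AV_not_incoming s t : AV s t != 0 -> ~ II s.
Proof.
move=> /crossing_trans_neq0[a /crossing_value_ends[w [z [[dw dz wz] Uw sw
  tz]]]] Is.
apply: Uw; exact: incoming_into Is dw sw.
Qed.

Local Notation listU := (enum_fset (fset_set (states (subchain D U)))).

Lemma D_states s : states (subchain D Sigma) s <-> strands D s.
Proof. exact: strands_in_Sigma. Qed.

Section Schur.
Variables G GU : set (plane R) -> set (plane R) -> ZT.
Hypothesis eqnD : forall t, strands D t ->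
    green_eqn (subchain D Sigma) t (G^~ t).
Hypothesis solU : forall x b : set (plane R) -> ZT,
  (forall s, SU s -> x s = b s + \sum_(u <- listU) AU s u * x u) ->
  forall s, SU s -> x s = \sum_(u <- listU) GU s u * b u.

(** The columns of [A_U] are zero at a strand shared with the complement which
    is not outgoing, so the walk of length 0 is the only one into it. *)
Lemma GU_not_outgoing s t : SU s -> SU t -> SV t -> ~ OO t -> GU s t = (s == t)%:R.
Proof.
move=> Us Ut Vt nOt.
rewrite (solU (x := fun s => (s == t)%:R) (b := fun s => (s == t)%:R)) //.
  have tU : t \in listU by rewrite mem_states; exact/asboolP.
  rewrite (big_rem t tU)/= eqxx mulr1 big1_seq ?addr0// => u.
  have ut : uniq listU by exact: fset_uniq.
  by rewrite mem_rem_uniq// inE => /andP[_ /andP[/negPf -> _]]; rewrite mulr0.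
move=> v Uv; rewrite big1 ?addr0// => u _; have [->|_] := eqVneq u t;
  last by rewrite mulr0.
have [->|/(AU_outgoing Vt)//] := eqVneq (AU v t) 0; by rewrite mul0r.
Qed.

(** Restricted to the strands of [U], the column of [G_D] solves
    [x = b + A_U x], with [b = x] on outgoing strands and the Kronecker symbol
    elsewhere: a strand of [U] that is not outgoing has all its transitions
    inside [U], and an outgoing one has none there. *)
Lemma G_through_U s t : SU s -> strands D t ->
  G s t = \sum_(u <- listU) GU s u * (if `[< OO u >] then G u t else (u ==
    t)%:R).
Proof.
move=> Us Dt.
apply: (solU (x := G^~ t) (b := fun u =>
  if `[< OO u >] then G u t else (u == t)%:R)) => // v Uv.
have Dv : strands D v by case: Uv.
case: asboolP => [[_ Vv Ov]|nOv].
  rewrite big1 ?addr0// => u _.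
  have [->|AUvu] := eqVneq (AU v u) 0; first by rewrite mul0r.
  by case: (incoming_not_outgoing U_avoid U_strands (AU_incoming Vv AUvu)).
rewrite (eqnD Dt ((D_states v).2 Dv)); congr (_ + _).
have UD : states (subchain D U) `<=` states (subchain D Sigma).
  by move=> u [Du _]; apply/D_states.
rewrite -(sum_substates UD); last first.
  move=> u /D_states Du nUu; have [->|/(AU_states Dv Du)[_ Uu]//] :=
    eqVneq (AU v u) 0.
  by rewrite mul0r.
rewrite big_seq [RHS]big_seq; apply: eq_bigr => u; rewrite mem_states =>
  /asboolP/D_states Du.
congr (_ * _); rewrite /= (crossing_trans_split no_closed U Dv Du).
have [->|AVvu] := eqVneq (AV v u) 0; first by rewrite addr0.
have [Vv _] := AV_states Dv Du AVvu.
have [Iv|//] := shared_strand no_closed hU Uv Vv.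
by case: (AV_not_incoming AVvu).
Qed.

Hypothesis greenU : forall s u, SU s -> SU u ->
    green R (subchain D U) s u = GU s u.

(** Rows of strands that are not incoming are those of [A_D]. For an incoming
    strand, the terms of [G_through_U] with [u] outgoing are the row of the
    contraction, and the remaining ones reduce to the Kronecker symbol. *)
Lemma contraction_eqn t : SV t -> green_eqn (diagram_contraction D U) t (G^~ t).
Proof.
move=> Vt s Vs; have Ds : strands D s by case: Vs.
have Dt : strands D t by case: Vt.
have [Is|nIs] := EM (II s); last first.
  rewrite (eqnD Dt ((D_states s).2 Ds)); congr (_ + _).
  have AUs0 u : AU s u = 0 by apply/eqP/negPn/negP => /(AU_incoming Vs).
  have VD : states (diagram_contraction D U) `<=` states (subchain D Sigma).
    by move=> u [Du _]; apply/D_states.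
  rewrite (sum_substates VD); last first.
    move=> u /D_states Du nVu; rewrite /= (crossing_trans_split no_closed U Ds
      Du) AUs0 add0r.
    by have [->|/(AV_states Ds Du)[]//] := eqVneq (AV s u) 0; rewrite mul0r.
  apply: eq_bigr => u _; congr (_ * _); rewrite /=.
  by case: asboolP => // -[].
have [Us _ _] := Is.
have nOs := incoming_not_outgoing U_avoid U_strands Is.
rewrite (G_through_U Us Dt).
have -> : \sum_(u <- listU) GU s u * (if `[< OO u >] then G u t else (u ==
    t)%:R) =
  \sum_(u <- listU) (if `[< OO u >] then GU s u * G u t else 0) +
  \sum_(u <- listU) (if `[< OO u >] then 0 else GU s u * (u == t)%:R).
  rewrite -big_split; apply: eq_bigr => u _ /=.
  by case: ifP => _; rewrite ?addr0 ?add0r.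
rewrite addrC; congr (_ + _).
  have [[Ut nOt]|nt] := EM (SU t /\ ~ OO t).
    have tU : t \in listU by rewrite mem_states; exact/asboolP.
    rewrite (big_rem t tU)/= asboolF// eqxx mulr1 big1_seq ?addr0.
      exact: GU_not_outgoing.
    move=> u; have ut : uniq listU by exact: fset_uniq.
    rewrite mem_rem_uniq// inE => /andP[_ /andP[/negPf -> _]].
    by rewrite mulr0; case: ifP.
  rewrite big1_seq.
    case: eqP => // st; case: nt; rewrite -st; by split.
  move=> u /andP[_]; rewrite mem_states => /asboolP Uu; case: asboolP => // nOu.
  case: eqP => [ut|_]; last by rewrite mulr0.
  by case: nt; rewrite -ut.
pose F u := if `[< OO u >] then GU s u * G u t else 0.
pose P : set (set (plane R)) := [set u | OO u].
have PU : P `<=` SU by move=> u [].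
have PV : P `<=` SV by move=> u [].
have finP : finite_set P by apply: sub_finite_set PU (strands_in_finite D U).
(* [MP] only serves to enumerate the outgoing strands. *)
pose MP := MarkovChain finP (fun _ _ => 0).
transitivity (\sum_(u <- enum_fset (fset_set (states MP))) F u).
  apply: (@sum_substates _ _ MP (subchain D U)) => // u _ nOu;
    rewrite /F asboolF//.
rewrite -(@sum_substates _ _ MP (diagram_contraction D U)) //; last first.
  by move=> u _ nOu; rewrite /F asboolF.
rewrite big_seq [RHS]big_seq; apply: eq_bigr => u; rewrite mem_states =>
  /asboolP Vu.
have Du : strands D u by case: Vu.
rewrite /F /=; case: asboolP => Ou.
  by rewrite asboolT// greenU//; case: Ou.
rewrite asboolF; last by case.
rewrite (crossing_trans_split no_closed U Ds Du).
have -> : AU s u = 0 by apply/eqP/negPn/negP => /(AU_outgoing Vu).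
have -> : AV s u = 0 by apply/eqP/negPn/negP => /AV_not_incoming.
by rewrite addr0 mul0r.
Qed.
End Schur.

(** The new transitions are values of [G_U], which at [T = 1] lead from an
    incoming strand to a different strand lying further along. *)
Lemma contraction_triangular (GU : set (plane R) -> set (plane R) -> ZT) :
  (forall s t, SU s -> SU t -> regular_at (GU s t) (1 : R[i])) ->
  (forall s u, SU s -> SU u -> green R (subchain D U) s u = GU s u) ->
  (forall s u, SU s -> SU u -> ZT_eval (GU s u) (1 : R[i]) != 0 ->
     s = u \/ strand_pos D s < strand_pos D u) ->
  (forall s t, states (diagram_contraction D U) s ->
    states (diagram_contraction D U) t ->
     regular_at (trans (diagram_contraction D U) s t) (1 : R[i])) /\
  (forall s t, states (diagram_contraction D U) s ->
    states (diagram_contraction D U) t ->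
     ZT_eval (trans (diagram_contraction D U) s t) (1 : R[i]) != 0 ->
     strand_pos D s < strand_pos D t).
Proof.
move=> rGU greenU posGU; split=> s t Vs Vt /=; case: asboolP => [[Is Ot]|_].
- by rewrite greenU; [apply: rGU| |]; case: Is => //; case: Ot.
- by apply: (@subchain_regular R Sigma D no_closed Sigma); apply/D_states;
    [case: Vs|case: Vt].
- have [Us _ _] := Is; have [Ut _ _] := Ot.
  rewrite greenU// => /(posGU _ _ Us Ut)[st|//].
  by case: (incoming_not_outgoing U_avoid U_strands Is); rewrite st.
- by apply: (@subchain_increasing R Sigma D no_closed Sigma); apply/D_states;
    [case: Vs|case: Vt].
Qed.
End Contraction.

Theorem proposition3p2 (R : realType) (Sigma : set (plane R))
  (hSigma : planar_surface Sigma)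
  (D : tangle_diagram Sigma)
  (no_closed : forall k : component D, ~~ is_circle k)
  (U : set (plane R))
  (hU : planar_surface U)
  (U_int : U `<=` Sigma°)
  (U_transverse : forall x : component D * R, pts x -> bdry U (point_of x) ->
     transverse_to_bdry U (point_of x) (velocity x))
  (U_avoid : forall p, crossing_points D p -> ~ bdry U p)
  (U_strands : forall s p q, strands D s -> s p -> bdry U p ->
     s q -> bdry U q -> p = q) :
  green_well_defined R (diagram_contraction D U) /\
  forall s t : set (plane R),
    states (diagram_contraction D U) s -> states (diagram_contraction D U) t ->
    green R (diagram_contraction D U) s t = green R (diagram_chain D) s t.
Proof.
have regD := @subchain_regular R Sigma D no_closed.
have incD := @subchain_increasing R Sigma D no_closed.
have [G [rG eqnG _]] := green_eqn_solution (regD Sigma) (incD Sigma).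
have [GU [rGU eqnGU solU]] := green_eqn_solution (regD U) (incD U).
have greenU := greenE (regD U) (incD U) rGU eqnGU.
have posGU := green_value1 (regD U) (incD U) rGU eqnGU.
have [regV incV] := contraction_triangular no_closed U_avoid U_strands rGU greenU
    posGU.
have VD u : states (diagram_contraction D U) u -> states (subchain D Sigma) u.
  by case=> Du _; apply/D_states.
have rGV s t : states (diagram_contraction D U) s ->
    states (diagram_contraction D U) t ->
    regular_at (G s t) (1 : R[i]).
  by move=> /VD Ds /VD Dt; exact: rG.
have eqnV t : states (diagram_contraction D U) t ->
    green_eqn (diagram_contraction D U) t (G^~ t).
  apply: contraction_eqn solU greenU _ => // u Du.
  by apply: eqnG; apply/D_states.
split.
  exists G; exact (green_atP (M := diagram_contraction D U) regV incV rGV eqnV).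
move=> s t Vs Vt; rewrite (greenE (M :=
  diagram_contraction D U) regV incV rGV eqnV Vs Vt).
by rewrite (greenE (regD Sigma) (incD Sigma) rG eqnG (VD _ Vs) (VD _ Vt)).
Qed.
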